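(* Let $b>1$ be an integer, let $A\subset\{0,1,\dots,b-1\}$ contain at least one non-zero element, let $N=\#A$ and $A_1=A\setminus\{0\}$. Let $\alpha(s)=\prod_{n=0}^\infty(1-b^{-s-n}N)$, and let $K(s)$ and $(u_m(s))_{m\ge0}$ be as defined in the context. Then the series, whose terms are entire functions, $$\sum_{m=0}^\infty(-1)^m\frac{(s)_m}{m!}\,\alpha(s)\,u_m(s)\sum_{a_1\in A_1,\ a_2\in A}(a_1b+a_2)^{-s-m}$$ converges everywhere in the complex plane and defines an entire function which gives the analytic continuation of $\alpha(s)\bigl(K(s)-\sum_{a\in A_1}a^{-s}\bigr)$ (initially defined for $\Re s>\log_bN$). Consequently, $K(s)$ extends to a meromorphic function in the complex plane whose poles are all simple and located among the zeros of $\alpha(s)$.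
   Context: An integer $n>0$ is called admissible if all digits of its (minimal) base-$b$ representation belong to $A$. $K(s)=\sum' n^{-s}$, the sum being over all admissible integers $n>0$; it converges absolutely for $\Re s>\log_bN$. $(s)_m=s(s+1)\cdots(s+m-1)$ is the Pochhammer symbol, with $(s)_0=1$. Put $\gamma_j=\sum_{a\in A}a^j$. The meromorphic functions $u_m(s)$ on $\mathbb{C}$ are defined by $u_0(s)=\dfrac{b^s}{b^s-N}$ and, for $m\ge1$, by $$(b^{s+m}-N)\,u_m(s)=\sum_{j=1}^m\binom{m}{j}\gamma_j\,u_{m-j}(s).$$ (For $\Re s>\log_b N$ one has $u_m(s)=0^m+\sum_{l\ge1}\sum_{(a_1,\dots,a_l)\in A^l}(a_1b^{-1}+\dots+a_lb^{-l})^m b^{-ls}$, with $0^0=1$.) The products $\alpha(s)u_m(s)$ are entire functions; at poles of $u_m$ the product is understood as the value of this entire function. *)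

(* Defs.v *)
From mathcomp Require Export all_boot all_order all_algebra.
From mathcomp Require Export complex.
From mathcomp Require Export all_classical all_reals all_analysis.

Set Implicit Arguments.
Unset Strict Implicit.
Unset Printing Implicit Defensive.

Export Order.TTheory GRing.Theory Num.Theory.
Export numFieldNormedType.Exports.

Local Open Scope classical_set_scope.
Local Open Scope ring_scope.
Local Open Scope complex_scope.

(* The regular module [R[i]^o] is the copy of [R[i]] that carries the norm and
   topology instances, over the scalar field [R[i]] itself. In particular,
   [derivable f z 1] on this type is complex differentiability. *)
Notation Cplx R := (R[i])^o.

Section Holomorphy.
Context {R : realType}.
Local Notation C := (Cplx R).
Implicit Types (f : C -> C) (p : C).

Definition holomorphic_at f p := \forall z \near p, derivable f z 1.

Definition entire f := forall z : C, derivable f z 1.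

Definition pole_of_order f p (k : nat) :=
  (0 < k)%N /\
  exists g : C -> C, [/\ holomorphic_at g p, g p != 0 &
    \forall z \near p^', f z = g z / (z - p) ^+ k].

(* The value taken at a pole is irrelevant. *)
Definition meromorphic f :=
  forall p, holomorphic_at f p \/ exists k, pole_of_order f p k.

End Holomorphy.

Section Kempner.
Context {R : realType}.
Local Notation C := (Cplx R).

Definition cexp (z : C) : C :=
  (expR (complex.Re z))%:C * (cos (complex.Im z) +i* sin (complex.Im z)).

(* [n ^ s], meaningful for [0 < n] only. *)
Definition npow (n : nat) (s : C) : C := cexp (s * (ln (n%:R : R))%:C).

Definition pochhammer (s : C) (m : nat) : C := \prod_(0 <= i < m) (s + i%:R).

Variables (b : nat) (A : {set 'I_b}).

(* For [1 < b] and [0 < n], the minimal base-[b] representation of [n] has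
   [(trunc_log b n).+1] digits. *)
Definition admissible (n : nat) : bool :=
  (0 < n)%N &&
  [forall i : 'I_(trunc_log b n).+1,
     [exists a in A, (a : nat) == ((n %/ b ^ i) %% b)%N]].

Definition kempner (s : C) : C :=
  limn (fun k => \sum_(0 <= n < k | admissible n) npow n (- s)).

Definition nonzero_digits : {set 'I_b} := [set a in A | (a : nat) != 0%N].

Definition gamma (j : nat) : C := \sum_(a in A) (a%:R : C) ^+ j.

Definition alpha (s : C) : C :=
  limn (fun k => \prod_(0 <= n < k) (1 - npow b (- s - n%:R) * #|A|%:R)).

(* [:: u_0 s; ...; u_m s], each value being computed from the previous ones. *)
Fixpoint useq (m : nat) (s : C) : seq C :=
  if m is m'.+1 then
    rcons (useq m' s)
      ((\sum_(1 <= j < m.+1) ('C(m, j))%:R * gamma j * (useq m' s)`_(m - j))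
         / (npow b (s + m%:R) - #|A|%:R))
  else [:: npow b s / (npow b s - #|A|%:R)].

(* A divisor may vanish on a discrete set, where this value is not
   significant. *)
Definition u (m : nat) (s : C) : C := (useq m s)`_m.

(* The entire function extending [alpha * u m] across the poles of [u m]: its
   value at [s] is the limit of the product along the punctured
   neighbourhoods of [s]. *)
Definition alpha_u (m : nat) (s : C) : C :=
  lim (alpha w * u m w @[w --> s^']).

Definition kempner_term (m : nat) (s : C) : C :=
  (-1) ^+ m * (pochhammer s m / m`!%:R) * alpha_u m s *
  \sum_(a1 in nonzero_digits) \sum_(a2 in A) npow (a1 * b + a2)%N (- s - m%:R).

Lemma size_useq m s : size (useq m s) = m.+1.
Proof. by elim: m => //= m IH; rewrite size_rcons IH. Qed.

Lemma nth_useq m k s : (k <= m)%N -> (useq m s)`_k = u k s.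
Proof.
elim: m => [|m IH]; first by rewrite leqn0 => /eqP ->.
rewrite leq_eqVlt => /predU1P[-> //|]; rewrite ltnS => km.
by rewrite /= nth_rcons size_useq ltnS km IH.
Qed.

Lemma u0E s : u 0 s = npow b s / (npow b s - #|A|%:R).
Proof. by []. Qed.

Lemma u_rec m s : (0 < m)%N -> npow b (s + m%:R) != #|A|%:R ->
  (npow b (s + m%:R) - #|A|%:R) * u m s =
  \sum_(1 <= j < m.+1) ('C(m, j))%:R * gamma j * u (m - j) s.
Proof.
case: m => // m _ nz.
rewrite {1}/u /= nth_rcons size_useq ltnn eqxx mulrCA divff ?subr_eq0// mulr1.
apply: eq_big_nat => j /andP[j0 _]; rewrite nth_useq //.
by case: j j0 => // j _; rewrite subSS leq_subr.
Qed.

End Kempner.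

(* Main.v *)
(** Write an admissible integer with at least two digits as [n * b ^ l + y], where
    [n = a1 * b + a2] carries its two leading digits and [y / b ^ l = x] is a
    fraction with digits in [A]. Then [(n * b ^ l + y)^-s] equals
    [b^(-l s) n^-s (1 + x / n)^-s], where [x / n <= 1 / 2]; expanding the binomial
    series and summing over [l] and the digits of [x] turns [K(s)] into the stated
    series, since the sum of [b^(-l s) x^m] solves the recursion of [u_m].

    All functions involved are built from exponentials by products and infinite
    series, so instead of Cauchy's theory it suffices to control their finite
    Taylor expansions at each point, with a submultiplicative norm on the
    remainders. Multiplying by [alpha] clears the denominators of the [u_m], and
    the recursion shows that [alpha u_m] grows at most like [(3 / 2)^m], while the
    sums of [n^(-s-m)] decay like [b^-m]. Finally the zeros of [alpha] are simple,
    as its factors have simple zeros that are pairwise distinct. *)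

Require Import Defs.
From mathcomp Require Import ring lra.

Set Implicit Arguments.
Unset Strict Implicit.
Unset Printing Implicit Defensive.

Local Open Scope classical_set_scope.
Local Open Scope ring_scope.

(** * Limits and neighbourhoods through a real-valued modulus *)

Section ComplexNorm.
Local Open Scope complex_scope.
Context {R : realType}.
Local Notation C := (Cplx R).
Implicit Types (x y z w : C) (r e : R).

(** Each use of a remainder costs one order: the derivative at a point is the value of the first
    remainder there, whose continuity asks for one order more, and dividing [alpha] by [h] at a zero
    costs another. Hence jets are carried at every order [k] at once. The identity theorem is
    replaced by continuity: the recursion for [alpha_u], and the agreement of the limit defining it
    with an explicit product, are checked on punctured discs where no denominator vanishes, and then
    extended to the centre. In the half plane the double sum over [l] and [m] is not rearranged as a
    double series: the levels are cut at [L], where the exchange with the series in [m] is finite,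
    and [L] tends to infinity under a majorant independent of [L]. The non-zero digit enters there
    through [N >= 1]: it gives [log_b N >= 0], hence [Re s > 0], on which both the binomial
    remainder and the size of [n^(-s)] on each level rely. *)

Definition cabs (z : C) : R := complex.Re `|z|.

Lemma normr_cabs z : `|z| = (cabs z)%:C.
Proof. by rewrite /cabs RRe_real// normr_real. Qed.

Lemma cabsE z : cabs z = Num.sqrt (complex.Re z ^+ 2 + complex.Im z ^+ 2).
Proof. exact: (congr1 (@complex.Re R) (normc_def z)). Qed.

Lemma cabs_ge0 z : 0 <= cabs z.
Proof. by rewrite cabsE sqrtr_ge0. Qed.

Lemma cabsM z w : cabs (z * w) = cabs z * cabs w.
Proof. by apply: complexI; rewrite rmorphM/= -!normr_cabs normrM. Qed.

Lemma cabs1 : cabs 1 = 1.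
Proof. by apply: complexI; rewrite -normr_cabs normr1. Qed.

Lemma cabs0 : cabs 0 = 0.
Proof. by apply: complexI; rewrite -normr_cabs normr0. Qed.

Lemma cabsV z : cabs z^-1 = (cabs z)^-1.
Proof. by apply: complexI; rewrite fmorphV/= -!normr_cabs normfV. Qed.

Lemma cabsX z n : cabs (z ^+ n) = cabs z ^+ n.
Proof. by apply: complexI; rewrite rmorphXn/= -!normr_cabs normrX. Qed.

Lemma cabsN z : cabs (- z) = cabs z.
Proof. by apply: complexI; rewrite -!normr_cabs normrN. Qed.

Lemma cabsB z w : cabs (z - w) = cabs (w - z).
Proof. by rewrite -cabsN opprB. Qed.

Lemma cabsR r : cabs r%:C = `|r|.
Proof. by rewrite cabsE/= expr0n/= addr0 sqrtr_sqr. Qed.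

Lemma cabs_nat n : cabs (n%:R : C) = n%:R.
Proof. by apply: complexI; rewrite -normr_cabs normr_nat rmorph_nat. Qed.

Lemma cabsD z w : cabs (z + w) <= cabs z + cabs w.
Proof. by rewrite -lecR rmorphD/= -!normr_cabs ler_normD. Qed.

Lemma cabs_sub z w : cabs (z - w) <= cabs z + cabs w.
Proof. by rewrite -[cabs w]cabsN cabsD. Qed.

Lemma cabs_subD z w : cabs z - cabs w <= cabs (z - w).
Proof. by rewrite lerBlDr -{1}(subrK w z) cabsD. Qed.

Lemma cabs_eq0 z : (cabs z == 0) = (z == 0).
Proof. by rewrite -(inj_eq (@complexI R)) -normr_cabs normr_eq0. Qed.

Lemma cabs_gt0 z : (0 < cabs z) = (z != 0).
Proof. by rewrite lt_neqAle cabs_ge0 eq_sym cabs_eq0 andbT. Qed.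

Lemma cabs_sum (I : Type) (s : seq I) (P : pred I) (F : I -> C) :
  cabs (\sum_(i <- s | P i) F i) <= \sum_(i <- s | P i) cabs (F i).
Proof.
elim/big_rec2: _ => [|i y x _ h]; first by rewrite cabs0.
by apply: (le_trans (cabsD _ _)); rewrite lerD2l.
Qed.

Lemma cabs_prod (I : Type) (s : seq I) (P : pred I) (F : I -> C) :
  cabs (\prod_(i <- s | P i) F i) = \prod_(i <- s | P i) cabs (F i).
Proof. by apply: (big_morph _ cabsM cabs1). Qed.

Lemma Re_le_cabs z : `|complex.Re z| <= cabs z.
Proof. by rewrite -lecR -normr_cabs normc_ge_Re. Qed.

Lemma Im_le_cabs z : `|complex.Im z| <= cabs z.
Proof. by rewrite cabsE -sqrtr_sqr ler_sqrt ?lerDr ?addr_ge0 ?sqr_ge0. Qed.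

Lemma cabs_le_ReIm z : cabs z <= `|complex.Re z| + `|complex.Im z|.
Proof.
rewrite cabsE -[leRHS]ger0_norm ?addr_ge0// -[leRHS]sqrtr_sqr ler_sqrt ?sqr_ge0//.
rewrite sqrrD !real_normK ?num_real//.
by rewrite addrAC lerDl mulrn_wge0// mulr_ge0.
Qed.

Lemma ltc_cabs z (e : R[i]) : 0 < e -> (`|z| < e) = (cabs z < complex.Re e).
Proof.
move=> e0; have er : e = (complex.Re e)%:C by rewrite RRe_real// gtr0_real.
by rewrite normr_cabs {1}er ltcR.
Qed.

Lemma cvg_cabs (T : Type) (F : set_system T) {FF : Filter F} (f : T -> C) (l : C) :
  (f x @[x --> F] --> l) <-> (cabs (f x - l) @[x --> F] --> (0 : R)).
Proof.
split=> [/cvgrPdist_lt h|/cvgrPdist_lt h]; apply/cvgrPdist_lt.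
  move=> e e0; have := h e%:C; rewrite ltcR => /(_ e0).
  apply: filterS => x /=; rewrite ltc_cabs ?ltcR//= cabsB => ?.
  by rewrite sub0r normrN ger0_norm ?cabs_ge0.
move=> e e0; have e0' : 0 < complex.Re e by move: (e0); rewrite ltcE => /andP[].
have := h _ e0'; apply: filterS => x /=.
by rewrite sub0r normrN ger0_norm ?cabs_ge0// ltc_cabs// cabsB.
Qed.

Lemma cabs_lt_cvg (T : Type) (F : set_system T) {FF : Filter F} (f : T -> C) (l : C) :
  (forall e : R, 0 < e -> \forall x \near F, cabs (f x - l) < e) ->
  f x @[x --> F] --> l.
Proof.
move=> h; apply/cvg_cabs/cvgrPdist_lt => e /h; apply: filterS => x.
by rewrite sub0r normrN ger0_norm ?cabs_ge0.
Qed.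

Lemma cvg_cabs_lt (T : Type) (F : set_system T) {FF : Filter F} (f : T -> C) (l : C) :
  f x @[x --> F] --> l ->
  forall e : R, 0 < e -> \forall x \near F, cabs (f x - l) < e.
Proof.
move=> /cvg_cabs/cvgrPdist_lt h e /h; apply: filterS => x.
by rewrite sub0r normrN ger0_norm ?cabs_ge0.
Qed.

Lemma nbhs_cabs (p : C) (P : C -> Prop) :
  (\forall z \near p, P z) <-> exists2 e : R, 0 < e & forall z, cabs (z - p) < e -> P z.
Proof.
split=> [/nbhs_ballP[e /= e0 h]|[e e0 h]].
  have e0' : 0 < complex.Re e by move: (e0); rewrite ltcE => /andP[].
  exists (complex.Re e) => // z zp; apply: h.
  by rewrite -ball_normE /ball_/= ltc_cabs// cabsB.
apply/nbhs_ballP; exists e%:C => /=; first by rewrite ltcR.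
move=> z; rewrite -ball_normE /ball_/= ltc_cabs ?ltcR//= cabsB; exact: h.
Qed.

Lemma dnbhs_cabs (p : C) (P : C -> Prop) :
  (\forall z \near p^', P z) <->
  exists2 e : R, 0 < e & forall z, cabs (z - p) < e -> z != p -> P z.
Proof.
rewrite /dnbhs /within /=; split=> [/nbhs_cabs//|h]; exact/nbhs_cabs.
Qed.

Lemma cvg_nbhs_cabs (f : C -> C) (p l : C) :
  (f z @[z --> p] --> l) <-> (forall e : R, 0 < e ->
    exists2 d : R, 0 < d & forall z, cabs (z - p) < d -> cabs (f z - l) < e).
Proof.
split=> [h e e0|h].
  exact/nbhs_cabs/(@cvg_cabs_lt _ _ (nbhs_filter p) _ _ h).
apply: (@cabs_lt_cvg _ _ (nbhs_filter p)) => e e0.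
exact/nbhs_cabs/h.
Qed.

Lemma cvg_dnbhs_cabs (f : C -> C) (p l : C) :
  (f z @[z --> p^'] --> l) <-> (forall e : R, 0 < e ->
    exists2 d : R, 0 < d &
      forall z, cabs (z - p) < d -> z != p -> cabs (f z - l) < e).
Proof.
split=> [h e e0|h].
  exact/dnbhs_cabs/(@cvg_cabs_lt _ _ (dnbhs_filter p) _ _ h).
apply: (@cabs_lt_cvg _ _ (dnbhs_filter p)) => e e0.
exact/dnbhs_cabs/h.
Qed.

Lemma cvg_nbhs_dnbhs (f : C -> C) (p l : C) :
  f z @[z --> p] --> l -> f z @[z --> p^'] --> l.
Proof.
move=> /cvg_nbhs_cabs h; apply/cvg_dnbhs_cabs => e /h[d d0 hd].
by exists d => // z zp _; exact: hd.
Qed.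

Lemma dnbhs_cvg_lim (f : C -> C) (p l : C) :
  f z @[z --> p^'] --> l -> lim (f z @[z --> p^']) = l.
Proof.
have pf : ProperFilter p^' by exact: Proper_dnbhs_numFieldType.
by move=> h; exact: (@cvg_lim C (@norm_hausdorff _ C) C p^' pf f l h).
Qed.

Lemma dnbhs_cvg_unique (f : C -> C) (p l l' : C) :
  f z @[z --> p^'] --> l -> f z @[z --> p^'] --> l' -> l = l'.
Proof. by move=> h h'; rewrite -(dnbhs_cvg_lim h) -(dnbhs_cvg_lim h'). Qed.

Lemma cvgn_limE (u : nat -> C) (l : C) : u @ \oo --> l -> limn u = l.
Proof. by move=> h; exact: (@cvg_lim C (@norm_hausdorff _ C) nat \oo _ u l h). Qed.

Lemma cvgn_sum (I : Type) (r : seq I) (P : pred I) (F : I -> nat -> C) (l : I -> C) :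
  (forall i, P i -> F i @ \oo --> l i) ->
  (fun n => \sum_(i <- r | P i) F i n) @ \oo --> \sum_(i <- r | P i) l i.
Proof.
move=> hF; elim: r => [|i r IH].
  have -> : (fun n => \sum_(i <- [::] | P i) F i n) = cst (0 : C).
    by apply/funext => n; rewrite big_nil.
  rewrite big_nil; exact: (@cvg_cst C).
rewrite big_cons; case Pi: (P i).
  have -> : (fun n => \sum_(j <- i :: r | P j) F j n) =
      (fun n => F i n + \sum_(j <- r | P j) F j n).
    by apply/funext => n; rewrite big_cons Pi.
  exact: (cvgD (hF i Pi) IH).
have -> // : (fun n => \sum_(j <- i :: r | P j) F j n) = (fun n => \sum_(j <- r | P j) F j n).
by apply/funext => n; rewrite big_cons Pi.
Qed.

Lemma cvgn_mull (c : C) (u : nat -> C) (l : C) :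
  u @ \oo --> l -> (fun n => c * u n) @ \oo --> c * l.
Proof. by move=> h; apply: cvgMl_tmp. Qed.

Lemma cvg_ReIm (u : nat -> C) (x y : R) :
  complex.Re (u n) @[n --> \oo] --> x -> complex.Im (u n) @[n --> \oo] --> y ->
  u @ \oo --> (x +i* y : C).
Proof.
move=> hx hy; apply/cvg_cabs.
have h0 : `|complex.Re (u n) - x| + `|complex.Im (u n) - y| @[n --> \oo] --> (0 : R).
  have -> : 0 = `|x - x| + `|y - y| :> R by rewrite !subrr normr0 addr0.
  by apply: cvgD; apply: cvg_norm; apply: cvgB => //; exact: cvg_cst.
apply: squeeze_cvgr (cvg_cst (0 : R)) h0; apply: nearW => n.
by rewrite cabs_ge0/=; apply: (le_trans (cabs_le_ReIm _)); case: (u n).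
Qed.

Lemma cvg_Re (T : Type) (F : set_system T) {FF : Filter F} (f : T -> C) (l : C) :
  f x @[x --> F] --> l -> complex.Re (f x) @[x --> F] --> complex.Re l.
Proof.
move=> /cvg_cabs /cvgrPdist_lt h; apply/cvgrPdist_lt => e e0.
apply: filterS (h e e0) => x /=; rewrite sub0r normrN ger0_norm ?cabs_ge0// => hx.
apply: le_lt_trans hx; rewrite cabsB; apply: le_trans (Re_le_cabs _).
by case: l {h}; case: (f x).
Qed.

Lemma cvg_cabs_lim (T : Type) (F : set_system T) {FF : Filter F} (f : T -> C) (l : C) :
  f x @[x --> F] --> l -> cabs (f x) @[x --> F] --> cabs l.
Proof. by move=> /cvg_norm /cvg_Re. Qed.

End ComplexNorm.

(** * Dominated series of complex numbers *)

Section Series.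
Local Open Scope complex_scope.
Context {R : realType}.
Local Notation C := (Cplx R).
Implicit Types (u v : nat -> C) (M : nat -> R) (B : R).

Lemma seriesE (V : zmodType) (w : nat -> V) n : series w n = \sum_(0 <= i < n) w i.
Proof. by []. Qed.

Lemma nneg_series_cvg M B : (forall n, 0 <= M n) ->
  (forall n, series M n <= B) -> cvgn (series M).
Proof.
move=> M0 MB; apply: nondecreasing_is_cvgn.
  by apply/nondecreasing_seqP => n; rewrite /series/= big_nat_recr//= lerDl.
by exists B => _ [n _ <-].
Qed.

Lemma abs_series_cvg u B : (forall n, \sum_(0 <= i < n) cabs (u i) <= B) ->
  cvgn (series u).
Proof.
move=> uB.
have hc (f : C -> R) : (forall z, `|f z| <= cabs z) -> cvgn (series (f \o u)).
  move=> hf; apply: normed_cvg; apply: (@nneg_series_cvg _ B) => n //=.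
  by apply: le_trans (uB n); apply: ler_sum => i _; exact: hf.
have hR := hc _ (@Re_le_cabs R); have hI := hc _ (@Im_le_cabs R).
have key n : (complex.Re (series u n) = series (@complex.Re R \o u) n) *
             (complex.Im (series u n) = series (@complex.Im R \o u) n).
  rewrite !seriesE; elim: n => [|n [IH1 IH2]]; first by rewrite !big_geq.
  by rewrite !big_nat_recr//= -IH1 -IH2; case: (\sum_(0 <= i < n) u i); case: (u n).
apply/cvg_ex; exists (limn (series (@complex.Re R \o u)) +i*
                      limn (series (@complex.Im R \o u))).
apply: cvg_ReIm.
- by under eq_fun do rewrite key.
- by under eq_fun do rewrite key.
Qed.

Lemma lim_series_le u B : (forall n, \sum_(0 <= i < n) cabs (u i) <= B) ->
  cabs (limn (series u)) <= B.
Proof.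
move=> uB; have /cvg_cabs_lim := abs_series_cvg uB.
move=> h; apply: (cvgr_to_le h); apply: nearW => n.
by apply: le_trans (uB n); exact: cabs_sum.
Qed.

Lemma series_dominated u M B : (forall i, cabs (u i) <= M i) ->
  (forall n, series M n <= B) -> forall n, \sum_(0 <= i < n) cabs (u i) <= B.
Proof. by move=> uM MB n; apply: le_trans (MB n); exact: ler_sum. Qed.

Lemma series_shift_cvg (V : normedModType R[i]) (w : nat -> V) n : cvgn (series w) ->
  series (fun i => w (n + i)%N) @ \oo --> limn (series w) - series w n.
Proof.
move=> cw.
have -> : series (fun i => w (n + i)%N) = (fun k => series w (k + n)%N - series w n).
  apply/funext => k; rewrite !seriesE (@big_cat_nat _ _ _ n 0 (k + n)%N)//= ?leq_addl//.
  rewrite addrAC subrr add0r -{2}[n]add0n big_addn addnK.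
  by apply: eq_bigr => i _; rewrite addnC.
by apply: cvgB; [rewrite cvg_shiftn|exact: cvg_cst].
Qed.

Lemma series_tail u M B n : (forall i, cabs (u i) <= M i) ->
  (forall n, series M n <= B) ->
  cabs (limn (series u) - series u n) <= B - series M n.
Proof.
move=> uM MB; have uB := series_dominated uM MB.
have /(series_shift_cvg (n := n)) cu := abs_series_cvg uB.
rewrite -(cvg_lim _ cu)//; apply: lim_series_le => k.
rewrite lerBrDr; apply: le_trans (MB (k + n)%N).
rewrite !seriesE (@big_cat_nat _ _ _ n 0 (k + n)%N)//= ?leq_addl//.
rewrite [leLHS]addrC lerD2l -{2}[n]add0n big_addn addnK.
by apply: ler_sum => i _; rewrite addnC.
Qed.

(** Beyond some [n] both tails are bounded by the tail of [M], and the first [n] terms converge one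
    by one. This lets the number [L] of levels tend to infinity inside the sum over [m]. *)
Lemma tannery (u : nat -> nat -> C) v M B :
  (forall L m, cabs (u L m) <= M m) -> (forall n, series M n <= B) ->
  (forall m, u L m @[L --> \oo] --> v m) ->
  limn (series (u L)) @[L --> \oo] --> limn (series v).
Proof.
move=> uM MB uv.
have M0 m : 0 <= M m by apply: le_trans (uM 0%N m); exact: cabs_ge0.
have vM m : cabs (v m) <= M m.
  have h : cabs (u L m) @[L --> \oo] --> cabs (v m) by exact: cvg_cabs_lim.
  by apply: (cvgr_to_le h); exact: nearW.
have cM := nneg_series_cvg M0 MB.
(* [B] is replaced by the sum of [M], so that the bound given by [series_tail] tends to 0 as [n]
   grows. *)
have MS n : series M n <= limn (series M).
  apply: nondecreasing_cvgn_le => //.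
  by apply/nondecreasing_seqP => k; rewrite /series/= big_nat_recr//= lerDl.
apply/cvg_cabs/cvgrPdist_lt => e e0.
have e4 : 0 < e / 4%:R by rewrite divr_gt0.
have /cvgrPdist_lt/(_ _ e4)[n _ /(_ n (leqnn n))/= hn] := cM.
have hfin : \sum_(0 <= m < n) cabs (u L m - v m) @[L --> \oo] --> (0 : R).
  elim: n {hn} => [|n IH]; first by under eq_fun do rewrite big_geq//; exact: cvg_cst.
  under eq_fun do rewrite big_nat_recr//=.
  have /cvg_cabs h := uv n.
  by have := cvgD IH h; rewrite addr0; exact.
have e2 : 0 < e / 2%:R by rewrite divr_gt0.
have /cvgrPdist_lt/(_ _ e2) := hfin.
apply: filterS => L /=.
rewrite !sub0r !normrN (ger0_norm (cabs_ge0 _)) ger0_norm; last first.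
  by apply: sumr_ge0 => i _; exact: cabs_ge0.
move=> hL.
have t1 := series_tail n (uM L) MS; have t2 := series_tail n vM MS.
have -> : limn (series (u L)) - limn (series v) =
   (limn (series (u L)) - series (u L) n) - (limn (series v) - series v n)
   + (series (u L) n - series v n) by ring.
have t3 : cabs (series (u L) n - series v n) < e / 2%:R.
  by rewrite !seriesE -sumrB; apply: le_lt_trans hL; exact: cabs_sum.
have hn' := ler_norm (limn (series M) - series M n).
have := cabsD (limn (series (u L)) - series (u L) n - (limn (series v) - series v n))
   (series (u L) n - series v n).
have := cabs_sub (limn (series (u L)) - series (u L) n) (limn (series v) - series v n).
by move: hn t1 t2 t3 hn'; lra.
Qed.

End Series.

(** * Jets *)

Section Jets.
Local Open Scope complex_scope.
Context {R : realType}.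
Local Notation C := (Cplx R).
Implicit Types (f g : C -> C) (r M N : R) (k : nat) (c h : C).

(* On the disc of radius [r], [f] is a polynomial of degree less than [k] plus
   [h ^+ k] times a bounded remainder, and the norm of these data, weighted by
   powers of [r], is at most [M]. As for power series, this norm is
   submultiplicative, which makes it stable under products, series and inverses
   without any recourse to Cauchy's theorem. *)
Fixpoint jet_le r k f M : Prop :=
  match k with
  | 0 => forall h, cabs h <= r -> cabs (f h) <= M
  | k'.+1 => exists c g N, [/\ jet_le r k' g N, cabs c + r * N <= M &
               forall h, cabs h <= r -> f h = c + h * g h]
  end.

Lemma jet_le_ge0 r k f M : 0 <= r -> jet_le r k f M -> 0 <= M.
Proof.
move=> r0; elim: k f M => [|k IH] f M /=.
  by move=> /(_ 0); rewrite cabs0 => /(_ r0); apply: le_trans; exact: cabs_ge0.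
move=> [c [g [N [/IH N0 h _]]]]; apply: le_trans h.
by rewrite addr_ge0 ?cabs_ge0 ?mulr_ge0.
Qed.

Lemma jet_le_trans r k f M N : jet_le r k f M -> M <= N -> jet_le r k f N.
Proof.
case: k => [|k] /= h MN; first by move=> x /h /le_trans; apply.
have [c [g [K [? hM ?]]]] := h; exists c, g, K; split=> //.
exact: le_trans hM MN.
Qed.

Lemma eq_jet_le r k f g M : (forall h, cabs h <= r -> f h = g h) ->
  jet_le r k f M -> jet_le r k g M.
Proof.
case: k => [|k] /= fg h; first by move=> x xr; rewrite -fg//; exact: h.
have [c [e [K [? ? hf]]]] := h; exists c, e, K; split=> // x xr.
by rewrite -fg// hf.
Qed.

Lemma jet_leW r k f M : 0 <= r -> jet_le r k.+1 f M -> jet_le r k f M.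
Proof.
move=> r0; elim: k f M => [|k IH] f M /= [c [g [N [hg hM hf]]]].
  move=> h hr; rewrite hf//; apply: le_trans hM; apply: le_trans (cabsD _ _) _.
  rewrite lerD2l cabsM; apply: le_trans (ler_wpM2r (cabs_ge0 _) hr) _.
  exact: ler_wpM2l (hg _ hr).
by exists c, g, N; split=> //; exact: IH.
Qed.

Lemma jet_le_sub r k j f M : 0 <= r -> (k <= j)%N -> jet_le r j f M -> jet_le r k f M.
Proof.
move=> r0; elim: j => [|j IH]; first by rewrite leqn0 => /eqP ->.
by rewrite leq_eqVlt => /predU1P[-> //|/IH{}IH] /(jet_leW r0).
Qed.

Lemma jet_le_bound r k f M h : 0 <= r -> jet_le r k f M -> cabs h <= r -> cabs (f h) <= M.
Proof. by move=> r0 /(jet_le_sub (k := 0) r0 (leq0n _))/= hf; exact: hf. Qed.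

Lemma jet_le_shrink s r k f M : 0 <= s -> s <= r -> jet_le r k f M -> jet_le s k f M.
Proof.
move=> s0 sr; have r0 := le_trans s0 sr.
elim: k f M => [|k IH] f M /=; first by move=> h x xs; apply: h; exact: le_trans xs sr.
move=> [c [g [N [hg hM hf]]]]; exists c, g, N; split; first exact: IH.
  by apply: le_trans hM; rewrite lerD2l ler_wpM2r// (jet_le_ge0 r0 hg).
by move=> h hs; apply: hf; exact: le_trans hs sr.
Qed.

Lemma jet_le_cst r k c : 0 <= r -> jet_le r k (fun=> c) (cabs c).
Proof.
move=> r0; elim: k c => [|k IH] c //=.
exists c, (fun=> 0), 0; split; first by have := IH 0; rewrite cabs0.
  by rewrite mulr0 addr0.
by move=> h _; rewrite mulr0 addr0.
Qed.

Lemma jet_le_affine r k c : 0 <= r -> jet_le r k (fun h => c + h) (cabs c + r).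
Proof.
case: k => [|k] r0 /=.
  by move=> h hr; apply: le_trans (cabsD _ _) _; rewrite lerD2l.
exists c, (fun=> 1), 1; split; first by rewrite -(@cabs1 R); exact: jet_le_cst.
  by rewrite mulr1.
by move=> h _; rewrite mulr1.
Qed.

Lemma jet_leD r k f g M N : 0 <= r -> jet_le r k f M -> jet_le r k g N ->
  jet_le r k (fun h => f h + g h) (M + N).
Proof.
move=> r0; elim: k f g M N => [|k IH] f g M N /=.
  move=> hf hg h hr; apply: le_trans (cabsD _ _) _.
  by rewrite lerD ?hf ?hg.
move=> [c [f1 [M1 [hf1 hM ef]]]] [d [g1 [N1 [hg1 hN eg]]]].
exists (c + d), (fun h => f1 h + g1 h), (M1 + N1); split; first exact: IH.
  by have := cabsD c d; lra.
by move=> h hr; rewrite ef// eg//; ring.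
Qed.

(** The remainder of [(c + h * f1) * g] is [c * g1 + f1 * g], where the second [g] is kept whole. As
    [|d| + r * N1 <= N], its weighted norm satisfies [|c| * |d| + r * (|c| * N1 + M1 * N) <= (|c| +
    r * M1) * N]. *)
Lemma jet_leM r k f g M N : 0 <= r -> jet_le r k f M -> jet_le r k g N ->
  jet_le r k (fun h => f h * g h) (M * N).
Proof.
move=> r0; elim: k f g M N => [|k IH] f g M N.
  move=> /= hf hg h hr; rewrite cabsM; apply: ler_pM; rewrite ?cabs_ge0//.
    exact: hf.
  exact: hg.
move=> [c [f1 [M1 [hf1 hM ef]]]] hg; have hg' := jet_leW r0 hg.
have [d [g1 [N1 [hg1 hN eg]]]] := hg.
exists (c * d), (fun h => c * g1 h + f1 h * g h), (cabs c * N1 + M1 * N); split.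
- by apply: jet_leD => //; apply: IH => //; exact: jet_le_cst.
- have N0 := jet_le_ge0 r0 hg.
  apply: le_trans (ler_wpM2r N0 hM); rewrite cabsM.
  have := ler_wpM2l (cabs_ge0 c) hN; nra.
- by move=> h hr; rewrite ef// eg//; ring.
Qed.

Lemma jet_leZ r k c f M : 0 <= r -> jet_le r k f M ->
  jet_le r k (fun h => c * f h) (cabs c * M).
Proof. by move=> r0 hf; apply: jet_leM => //; exact: jet_le_cst. Qed.

Lemma jet_leN r k f M : 0 <= r -> jet_le r k f M -> jet_le r k (fun h => - f h) M.
Proof.
move=> r0 /(jet_leZ (-1) r0); rewrite cabsN cabs1 mul1r; apply: eq_jet_le.
by move=> h _; rewrite mulN1r.
Qed.

Lemma jet_le_sum r k (I : Type) (s : seq I) (P : pred I) (F : I -> C -> C) (M : I -> R) :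
  0 <= r -> (forall i, P i -> jet_le r k (F i) (M i)) ->
  jet_le r k (fun h => \sum_(i <- s | P i) F i h) (\sum_(i <- s | P i) M i).
Proof.
move=> r0 hF; elim: s => [|i s IH].
  rewrite big_nil -(@cabs0 R); apply: (eq_jet_le _ (jet_le_cst k 0 r0)).
  by move=> h _; rewrite big_nil.
rewrite big_cons; case: ifP => Pi; last first.
  by apply: (eq_jet_le _ IH) => h _; rewrite big_cons Pi.
by apply: (eq_jet_le _ (jet_leD r0 (hF i Pi) IH)) => h _; rewrite big_cons Pi.
Qed.

Lemma jet_le_prod r k (I : Type) (s : seq I) (P : pred I) (F : I -> C -> C) (M : I -> R) :
  0 <= r -> (forall i, P i -> jet_le r k (F i) (M i)) ->
  jet_le r k (fun h => \prod_(i <- s | P i) F i h) (\prod_(i <- s | P i) M i).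
Proof.
move=> r0 hF; elim: s => [|i s IH].
  rewrite big_nil -(@cabs1 R); apply: (eq_jet_le _ (jet_le_cst k 1 r0)).
  by move=> h _; rewrite big_nil.
rewrite big_cons; case: ifP => Pi; last first.
  by apply: (eq_jet_le _ IH) => h _; rewrite big_cons Pi.
by apply: (eq_jet_le _ (jet_leM r0 (hF i Pi) IH)) => h _; rewrite big_cons Pi.
Qed.

(** The bound is that of the scalar geometric series, as in a Banach algebra. The remainder of
    [1 / (1 - f)] is [g / ((1 - c) * (1 - f))], and the estimate closes because
    [|1 - c| >= 1 - |c| >= 1 - q + r * N]. *)
Lemma jet_le_geom r k f q : 0 <= r -> jet_le r k f q -> q < 1 ->
  jet_le r k (fun h => (1 - f h)^-1) (1 - q)^-1.
Proof.
move=> r0; elim: k f q => [|k IH] f q hf q1.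
  move=> h hr; rewrite cabsV lef_pV2 ?posrE ?subr_gt0//; last first.
    by have := cabs_subD 1 (f h); have := hf _ hr; rewrite cabs1; lra.
  by have := cabs_subD 1 (f h); have := hf _ hr; rewrite cabs1; lra.
have {}IH := IH _ _ (jet_leW r0 hf) q1.
have nz h : cabs h <= r -> 1 - f h != 0.
  move=> /(jet_le_bound r0 hf) hq; rewrite -cabs_gt0.
  by have := cabs_subD 1 (f h); rewrite cabs1; lra.
have [c [g [N [hg hM ef]]]] := hf.
have N0 := jet_le_ge0 r0 hg.
have c1 : cabs c < 1 by have := mulr_ge0 r0 N0; lra.
have c1' : 1 - c != 0.
  by rewrite -cabs_gt0; have := cabs_subD 1 c; rewrite cabs1; lra.
exists (1 - c)^-1, (fun h => (1 - c)^-1 * (g h * (1 - f h)^-1)),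
  (cabs (1 - c)^-1 * (N * (1 - q)^-1)); split.
- by apply: jet_leZ => //; exact: jet_leM.
- rewrite cabsV.
  have -> : (cabs (1 - c))^-1 + r * ((cabs (1 - c))^-1 * (N / (1 - q))) =
            (1 - q + r * N) / (cabs (1 - c) * (1 - q)).
    by field; rewrite cabs_eq0 c1' andbT; lra.
  rewrite ler_pdivrMr ?mulr_gt0 ?cabs_gt0 ?subr_gt0//.
  have -> : (1 - q)^-1 * (cabs (1 - c) * (1 - q)) = cabs (1 - c) by field; lra.
  by have := cabs_subD 1 c; rewrite cabs1; lra.
- move=> h hr; have := nz _ hr; rewrite ef// => nz'.
  by field; rewrite c1' nz'.
Qed.

Lemma jet_le_cvg_series r k (f : nat -> C -> C) (M : nat -> R) (B : R) h :
  0 <= r -> (forall m, jet_le r k (f m) (M m)) -> (forall n, series M n <= B) ->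
  cabs h <= r -> cvgn (series (fun m => f m h)).
Proof.
move=> r0 hf hB hr; apply: (@abs_series_cvg _ _ B); apply: series_dominated hB.
by move=> i; exact: (jet_le_bound r0 (hf i)).
Qed.

(** This stands for the theorem that locally uniform limits of holomorphic functions are
    holomorphic. The constants and the remainders of the terms form two series, dominated by [B] and
    by [B / r], and the induction applies to the second. *)
Lemma jet_le_series r k (f : nat -> C -> C) (M : nat -> R) (B : R) :
  0 < r -> (forall m, jet_le r k (f m) (M m)) -> (forall n, series M n <= B) ->
  exists N, jet_le r k (fun h => limn (series (fun m => f m h))) N.
Proof.
move=> r_gt0; have r0 := ltW r_gt0.
elim: k f M B => [|k IH] f M B hf hB.
  exists B => h hr; apply: lim_series_le; apply: series_dominated hB => i.
  exact: hf.
have /choice[t ht] : forall m, exists t : C * (C -> C) * R,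
    [/\ jet_le r k t.1.2 t.2, cabs t.1.1 + r * t.2 <= M m &
     forall h, cabs h <= r -> f m h = t.1.1 + h * t.1.2 h].
  by move=> m; have [c [g [N ?]]] := hf m; exists (c, g, N).
have N0 m : 0 <= (t m).2 by have [/(jet_le_ge0 r0)] := ht m.
have cB n : \sum_(0 <= i < n) cabs (t i).1.1 <= B.
  apply: le_trans (hB n); apply: ler_sum => i _.
  by have [_ + _] := ht i; have := mulr_ge0 r0 (N0 i); lra.
have NB n : series (fun i => (t i).2) n <= B / r.
  rewrite ler_pdivlMr// mulrC; apply: le_trans (hB n).
  rewrite !seriesE mulr_sumr; apply: ler_sum => i _.
  by have [_ + _] := ht i; have := cabs_ge0 (t i).1.1; lra.
have hg m : jet_le r k (t m).1.2 (t m).2 by have [] := ht m.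
have [N hN] := IH _ _ _ hg NB.
exists (cabs (limn (series (fun m => (t m).1.1))) + r * N).
exists (limn (series (fun m => (t m).1.1))),
  (fun h => limn (series (fun m => (t m).1.2 h))), N; split=> // h hr.
apply: cvg_lim => //.
have -> : series (fun m => f m h) =
    (fun n => series (fun m => (t m).1.1) n + h * series (fun m => (t m).1.2 h) n).
  apply/funext => n; rewrite !seriesE mulr_sumr -big_split/=.
  by apply: eq_bigr => m _; have [_ _ ->] := ht m.
have c1 := abs_series_cvg cB.
have c2 := jet_le_cvg_series r0 hg NB hr.
by apply: cvgD; [exact: c1|apply: cvgMl_tmp; exact: c2].
Qed.

Lemma jet_le_cvg0 r k f M : 0 < r -> jet_le r k.+1 f M -> f h @[h --> (0 : C)] --> f 0.
Proof.
move=> r0 [c [g [N [hg _ hf]]]].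
have := jet_le_sub (ltW r0) (leq0n k) hg => /= {}hg.
have f0 : f 0 = c by rewrite hf ?cabs0 ?ltW// mul0r addr0.
apply/cvg_nbhs_cabs => e e0.
have N0 : 0 < `|N| + 1 by apply: ltr_wpDl.
exists (Num.min r (e / (`|N| + 1))); first by rewrite lt_min r0 divr_gt0.
move=> h; rewrite subr0 lt_min => /andP[/ltW hr].
rewrite ltr_pdivlMr// => he.
rewrite f0 hf// addrC addKr cabsM.
apply: le_lt_trans he; apply: ler_wpM2l; rewrite ?cabs_ge0//.
by apply: le_trans (hg _ hr) _; have := ler_norm N; lra.
Qed.

(** The difference quotient at [p] is [g] itself, so it only remains to know that [g] is continuous
    at 0, which a jet of order at least 1 for [g] provides. *)
Lemma jet_le_is_derive r k f M (p c : C) g : 0 < r -> jet_le r k.+1 g M ->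
  (forall h, cabs h <= r -> f (p + h) = c + h * g h) -> is_derive p 1 f (g 0).
Proof.
move=> r0 hg hf.
have fp : f p = c by have := hf 0; rewrite cabs0 addr0 mul0r addr0; apply; exact: ltW.
have cv : h^-1 *: ((f \o shift p) (h *: (1 : C)) - f p) @[h --> (0 : C)^'] --> g 0.
  have /cvg_nbhs_cabs hc := jet_le_cvg0 r0 hg.
  apply/cvg_dnbhs_cabs => e /hc[d d0 hd].
  exists (Num.min r d); first by rewrite lt_min r0.
  move=> h; rewrite subr0 lt_min => /andP[hr hhd] h0.
  have -> : h^-1 *: ((f \o shift p) (h *: (1 : C)) - f p) = g h.
    have sE (a b : C) : a *: b = a * b by [].
    rewrite /= !sE mulr1 addrC [h + p]addrC hf ?ltW// fp addKr.
    by rewrite mulKf.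
  by apply: hd; rewrite subr0.
apply: DeriveDef; first by apply/cvg_ex; exists (g 0).
exact: cvg_lim cv.
Qed.

Lemma jet_le_derivable r k f M (p : C) : 0 < r ->
  jet_le r k.+2 (fun h => f (p + h)) M -> derivable f p 1.
Proof.
move=> r0 [c [g [N [hg _ hf]]]].
by have [] := jet_le_is_derive r0 hg hf.
Qed.

Lemma jet_le_cvg r k f M (p : C) : 0 < r -> jet_le r k.+1 (fun h => f (p + h)) M ->
  f w @[w --> p] --> f p.
Proof.
move=> r0 /(jet_le_cvg0 r0); rewrite addr0 => /cvg_nbhs_cabs h.
apply/cvg_nbhs_cabs => e /h[d d0 hd].
exists d => // z zp.
by have := hd (z - p); rewrite subr0 subrKC; apply.
Qed.

Lemma cvg_near_neq0 f (p l : C) : f w @[w --> p] --> l -> l != 0 ->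
  exists2 d : R, 0 < d & forall z, cabs (z - p) < d -> f z != 0.
Proof.
rewrite -cabs_gt0 => /cvg_nbhs_cabs h /h[d d0 hd]; exists d => // z /hd.
rewrite -cabs_gt0 => hz; have := cabs_subD l (f z); rewrite cabsB.
by move: hz; lra.
Qed.

End Jets.

(** * Taylor bounds and the complex exponential *)

Section RealTaylor.
Local Open Scope complex_scope.
Context {R : realType}.
Implicit Types (f g : R -> R) (t T B : R).

Lemma is_derive_monomial (c t : R) k :
  is_derive t 1 (fun x => c * (x ^+ k.+1 / k.+1`!%:R)) (c * (t ^+ k / k`!%:R)).
Proof.
have -> : (fun x => c * (x ^+ k.+1 / k.+1`!%:R)) =
          (c / k.+1`!%:R) \*: ((@id R) ^+ k.+1).
  by apply/funext => x /=; rewrite /GRing.scale/= fctE mulrAC -mulrA.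
apply: is_derive_eq; rewrite /GRing.scale/= mulr1.
have k1 : (k.+1%:R : R) != 0 by rewrite pnatr_eq0.
have kf : (k`!%:R : R) != 0 by rewrite pnatr_eq0 -lt0n fact_gt0.
rewrite factS natrM; move: (k.+1%:R : R) (k`!%:R : R) k1 kf => a b a0 b0.
by field; rewrite a0 b0.
Qed.

Lemma is_derive_taylor_poly (a : nat -> R) t k :
  is_derive t 1 (fun x => \sum_(0 <= i < k.+1) a i * (x ^+ i / i`!%:R))
                (\sum_(0 <= i < k) a i.+1 * (t ^+ i / i`!%:R)).
Proof.
elim: k => [|k IH].
  have -> : (fun x => \sum_(0 <= i < 1) a i * (x ^+ i / i`!%:R)) = cst (a 0%N).
    by apply/funext => x; rewrite big_nat1 expr0 fact0 divr1 mulr1.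
  by rewrite big_geq//; exact: is_derive_cst.
have -> : (fun x => \sum_(0 <= i < k.+2) a i * (x ^+ i / i`!%:R)) =
   (fun x => \sum_(0 <= i < k.+1) a i * (x ^+ i / i`!%:R)) \+
   (fun x => a k.+1 * (x ^+ k.+1 / k.+1`!%:R)).
  by apply/funext => x; rewrite big_nat_recr.
rewrite big_nat_recr//=.
by apply: is_deriveD; exact: is_derive_monomial.
Qed.

Lemma derive_le_monomial f df B k T : f 0 = 0 ->
  (forall x, 0 <= x <= T -> is_derive x 1 f (df x)) ->
  (forall x, 0 <= x <= T -> df x <= B * (x ^+ k / k`!%:R)) ->
  forall t, 0 <= t <= T -> f t <= B * (t ^+ k.+1 / k.+1`!%:R).
Proof.
move=> f0 hf hdf t /andP[t0 tT].
pose g x := B * (x ^+ k.+1 / k.+1`!%:R) - f x.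
have sub x : x \in `[0, t] -> 0 <= x <= T.
  by rewrite in_itv/= => /andP[-> /le_trans]; apply.
have hg x : x \in `[0, t] -> is_derive x 1 g (B * (x ^+ k / k`!%:R) - df x).
  by move=> /sub/hf h; apply: is_deriveB; exact: is_derive_monomial.
pose dg x := B * (x ^+ k / k`!%:R) - df x.
have hoo x : x \in `]0, t[ -> is_derive x 1 g (dg x).
  by move=> h; apply: hg; exact: subset_itv_oo_cc h.
have hc : {within `[0, t], continuous g}.
  by apply: derivable_within_continuous => x /hg[].
have [c ct] := MVT_segment t0 hoo hc.
have -> : g 0 = 0 by rewrite /g f0 expr0n/= mul0r mulr0 subrr.
rewrite !subr0 => h.
have : 0 <= g t by rewrite h mulr_ge0// subr_ge0; exact/hdf/sub.
by rewrite subr_ge0.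
Qed.

(** The successive derivatives come as a family [g], known in closed form in both applications, the
    exponential and the power. The bound on the last one is integrated [k] times, from above and
    from below. *)
Lemma taylor_bound (g : nat -> R -> R) T B k :
  (forall i x, 0 <= x <= T -> is_derive x 1 (g i) (g i.+1 x)) ->
  (forall x, 0 <= x <= T -> `|g k x| <= B) ->
  forall t, 0 <= t <= T ->
  `|g 0%N t - \sum_(0 <= i < k) g i 0 * (t ^+ i / i`!%:R)| <= B * (t ^+ k / k`!%:R).
Proof.
elim: k g => [|k IH] g hg hB t tT.
  by rewrite big_geq// subr0 expr0 fact0 divr1 mulr1; exact: hB.
have {}IH := IH (fun i => g i.+1) (fun i => hg i.+1) hB.
pose f x := g 0%N x - \sum_(0 <= i < k.+1) g i 0 * (x ^+ i / i`!%:R).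
pose df x := g 1%N x - \sum_(0 <= i < k) g i.+1 0 * (x ^+ i / i`!%:R).
have f0 : f 0 = 0.
  rewrite /f big_nat_recl//= expr0 fact0 divr1 mulr1 big1 ?addr0 ?subrr// => i _.
  by rewrite expr0n/= mul0r mulr0.
have hf x : 0 <= x <= T -> is_derive x 1 f (df x).
  by move=> /(hg 0%N) h; apply: is_deriveB; exact: is_derive_taylor_poly.
rewrite ler_norml -lerN2 opprK; apply/andP; split.
- apply: (@derive_le_monomial (- f) (- df) _ _ T _ _ _ t tT).
  + by rewrite fctE f0 oppr0.
  + by move=> x /hf h; exact: is_deriveN.
  + move=> x /IH; rewrite ler_norml -lerN2 opprK => /andP[h _].
    by rewrite fctE.
- apply: (@derive_le_monomial f df _ _ T _ _ _ t tT) => // x /IH.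
  by rewrite ler_norml => /andP[].
Qed.

End RealTaylor.

Section ComplexExp.
Local Open Scope complex_scope.
Context {R : realType}.
Local Notation C := (Cplx R).
Implicit Types (z w h : C) (t x : R).

Lemma complex_eq z w : complex.Re z = complex.Re w -> complex.Im z = complex.Im w -> z = w.
Proof. by case: z w => [a b] [c d] /= -> ->. Qed.

Lemma ReM z w : complex.Re (z * w) =
  complex.Re z * complex.Re w - complex.Im z * complex.Im w.
Proof. by case: z w => [a b] [c d]. Qed.

Lemma ImM z w : complex.Im (z * w) =
  complex.Re z * complex.Im w + complex.Im z * complex.Re w.
Proof. by case: z w => [a b] [c d]. Qed.

Lemma ReD z w : complex.Re (z + w) = complex.Re z + complex.Re w.
Proof. by case: z w => [a b] [c d]. Qed.

Lemma ImD z w : complex.Im (z + w) = complex.Im z + complex.Im w.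
Proof. by case: z w => [a b] [c d]. Qed.

Lemma ReN z : complex.Re (- z) = - complex.Re z.
Proof. by case: z. Qed.

Lemma ImN z : complex.Im (- z) = - complex.Im z.
Proof. by case: z. Qed.

Lemma Re_sum (I : Type) (s : seq I) (P : pred I) (F : I -> C) :
  complex.Re (\sum_(i <- s | P i) F i) = \sum_(i <- s | P i) complex.Re (F i).
Proof. exact: (big_morph (@complex.Re R : C -> R) ReD erefl). Qed.

Lemma Im_sum (I : Type) (s : seq I) (P : pred I) (F : I -> C) :
  complex.Im (\sum_(i <- s | P i) F i) = \sum_(i <- s | P i) complex.Im (F i).
Proof. exact: (big_morph (@complex.Im R : C -> R) ImD erefl). Qed.

Lemma Re_cexp z : complex.Re (cexp z) = expR (complex.Re z) * cos (complex.Im z).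
Proof. by rewrite /cexp ReM /= mul0r subr0. Qed.

Lemma Im_cexp z : complex.Im (cexp z) = expR (complex.Re z) * sin (complex.Im z).
Proof. by rewrite /cexp ImM /= mul0r addr0. Qed.

Lemma cexpD z w : cexp (z + w) = cexp z * cexp w.
Proof.
apply: complex_eq.
  by rewrite [RHS]ReM !Re_cexp !Im_cexp ReD ImD expRD cosD; ring.
by rewrite [RHS]ImM !Re_cexp !Im_cexp ReD ImD expRD sinD; ring.
Qed.

Lemma cexpR x : cexp (x%:C : C) = (expR x)%:C.
Proof.
by apply: complex_eq; rewrite ?Re_cexp ?Im_cexp /= ?cos0 ?sin0 ?mulr1 ?mulr0.
Qed.

Lemma cexp0 : cexp (0 : C) = 1.
Proof. by have := cexpR 0; rewrite expR0. Qed.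

Lemma cabs_cexp z : cabs (cexp z) = expR (complex.Re z).
Proof.
rewrite cabsE Re_cexp Im_cexp !exprMn -mulrDr cos2Dsin2 mulr1 sqrtr_sqr.
by rewrite ger0_norm// expR_ge0.
Qed.

Lemma cexp_neq0 z : cexp z != 0.
Proof. by rewrite -cabs_gt0 cabs_cexp expR_gt0. Qed.

Lemma cexpN z : cexp (- z) = (cexp z)^-1.
Proof.
by apply: (mulIf (cexp_neq0 z)); rewrite -cexpD addNr cexp0 mulVf// cexp_neq0.
Qed.

Lemma cexpMn z n : cexp (n%:R * z) = cexp z ^+ n.
Proof.
elim: n => [|n IH]; first by rewrite mul0r cexp0.
by rewrite exprS -IH -cexpD -nat1r mulrDl mul1r.
Qed.

(** Componentwise, so that the real Taylor bound applies to each part of a complex function of a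
    real variable. *)
Definition is_cderive (t : R) (g : R -> C) (d : C) :=
  is_derive t 1 (fun x => complex.Re (g x)) (complex.Re d) /\
  is_derive t 1 (fun x => complex.Im (g x)) (complex.Im d).

(** Two choices of [phi] matter: the identity, for the exponential series, and [ln (1 + x)], for the
    binomial series. *)
Lemma is_cderive_cexp (w z : C) (phi : R -> R) (dphi t : R) :
  is_derive t 1 phi dphi ->
  is_cderive t (fun x => w * cexp (z * (phi x)%:C))
    (w * (z * dphi%:C) * cexp (z * (phi t)%:C)).
Proof.
move=> hphi.
pose a := complex.Re z; pose b := complex.Im z.
have eR x : complex.Re (z * (phi x)%:C) = a * phi x by rewrite ReM /= mulr0 subr0.
have eI x : complex.Im (z * (phi x)%:C) = b * phi x by rewrite ImM /= mulr0 add0r.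
have dphi' (c : R) : is_derive t 1 (c \*: phi) (c * dphi) by exact: is_deriveZ.
have dE : is_derive t 1 (expR \o (a \*: phi)) (expR (a * phi t) * (a * dphi)).
  exact: is_derive1_comp.
have dC : is_derive t 1 (cos \o (b \*: phi)) (- sin (b * phi t) * (b * dphi)).
  exact: is_derive1_comp.
have dS : is_derive t 1 (sin \o (b \*: phi)) (cos (b * phi t) * (b * dphi)).
  exact: is_derive1_comp.
have dEC := is_deriveM dE dC; have dES := is_deriveM dE dS.
split.
- have -> : (fun x => complex.Re (w * cexp (z * (phi x)%:C))) =
    (complex.Re w \*: ((expR \o (a \*: phi)) * (cos \o (b \*: phi)))) -
    (complex.Im w \*: ((expR \o (a \*: phi)) * (sin \o (b \*: phi)))).
    by apply/funext => x; rewrite ReM Re_cexp Im_cexp eR eI.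
  apply: is_derive_eq; rewrite /GRing.scale/=.
  rewrite (ReM (w * (z * dphi%:C))) (ReM w) (ImM w) (ReM z) (ImM z).
  rewrite Re_cexp Im_cexp eR eI /= /GRing.scale/= -/a -/b.
  by ring.
- have -> : (fun x => complex.Im (w * cexp (z * (phi x)%:C))) =
    (complex.Re w \*: ((expR \o (a \*: phi)) * (sin \o (b \*: phi)))) +
    (complex.Im w \*: ((expR \o (a \*: phi)) * (cos \o (b \*: phi)))).
    by apply/funext => x; rewrite ImM Re_cexp Im_cexp eR eI.
  apply: is_derive_eq; rewrite /GRing.scale/=.
  rewrite (ImM (w * (z * dphi%:C))) (ReM w) (ImM w) (ReM z) (ImM z).
  rewrite Re_cexp Im_cexp eR eI /= /GRing.scale/= -/a -/b.
  by ring.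
Qed.

Lemma taylor_boundC (G : nat -> R -> C) (T B : R) k :
  (forall i x, 0 <= x <= T -> is_cderive x (G i) (G i.+1 x)) ->
  (forall x, 0 <= x <= T -> cabs (G k x) <= B) ->
  forall t, 0 <= t <= T ->
  cabs (G 0%N t - \sum_(0 <= i < k) G i 0 * (t ^+ i / i`!%:R)%:C)
    <= 2 * B * (t ^+ k / k`!%:R).
Proof.
move=> hG hB t tT.
have hR := @taylor_bound R (fun i x => complex.Re (G i x)) T B k
  (fun i x xT => (hG i x xT).1) (fun x xT => le_trans (Re_le_cabs _) (hB x xT)) t tT.
have hI := @taylor_bound R (fun i x => complex.Im (G i x)) T B k
  (fun i x xT => (hG i x xT).2) (fun x xT => le_trans (Im_le_cabs _) (hB x xT)) t tT.
apply: le_trans (cabs_le_ReIm _) _.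
rewrite ReD ReN ImD ImN Re_sum Im_sum.
under eq_bigr do rewrite ReM /= mulr0 subr0.
under [in X in _ + X]eq_bigr do rewrite ImM /= mulr0 add0r.
by move: hR hI => /=; lra.
Qed.

Lemma cexp_taylor k h :
  cabs (cexp h - \sum_(0 <= i < k) (i`!%:R)^-1 * h ^+ i)
    <= 2 * expR (cabs h) * cabs h ^+ k.
Proof.
(* Restriction to the segment from 0 to [h]; the expansion is read off at [x = 1]. *)
pose G i (x : R) : C := h ^+ i * cexp (h * x%:C).
have hG i x : 0 <= x <= 1 -> is_cderive x (G i) (G i.+1 x).
  move=> _; have := @is_cderive_cexp (h ^+ i) h id 1 x (is_derive_id _ _).
  by rewrite mulr1 -exprSr.
have hB x : 0 <= x <= 1 -> cabs (G k x) <= cabs h ^+ k * expR (cabs h).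
  move=> /andP[x0 x1]; rewrite /G cabsM cabsX cabs_cexp ler_wpM2l ?exprn_ge0 ?cabs_ge0//.
  rewrite ler_expR ReM /= mulr0 subr0.
  apply: le_trans (ler_norm _) _; rewrite normrM (ger0_norm x0).
  apply: le_trans (Re_le_cabs h); exact: ler_piMr.
have := taylor_boundC hG hB (t := 1); rewrite ler01 lexx => /(_ isT).
rewrite /G mulr1 expr0 mul1r.
under eq_bigr do rewrite mulr0 cexp0 mulr1 expr1n mul1r.
have -> : \sum_(0 <= i < k) h ^+ i * ((i`!%:R)^-1)%:C = \sum_(0 <= i < k) (i`!%:R)^-1 * h ^+ i.
  by apply: eq_bigr => i _; rewrite mulrC fmorphV rmorph_nat.
move=> /le_trans; apply; rewrite expr1n mul1r.
have h0 : 0 <= cabs h ^+ k * expR (cabs h) by rewrite mulr_ge0 ?exprn_ge0 ?cabs_ge0 ?expR_ge0.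
have k1 : (k`!%:R)^-1 <= 1 :> R by rewrite invf_le1 ?ltr0n ?fact_gt0// ler1n fact_gt0.
apply: le_trans (_ : 2 * (cabs h ^+ k * expR (cabs h)) * 1 <= _); last by lra.
by apply: ler_wpM2l => //; rewrite mulr_ge0.
Qed.

(** Peeling off [a 0] and dividing by [h] turns an expansion of order [k.+1] into one of order [k]
    for the quotient, with the same [M]. *)
Lemma taylor_jet_le r k (f : C -> C) (a : nat -> C) (M : R) : 0 <= r -> 0 <= M ->
  (forall h, cabs h <= r -> cabs (f h - \sum_(0 <= i < k) a i * h ^+ i) <= M * cabs h ^+ k) ->
  exists N, jet_le r k f N.
Proof.
move=> r0 M0; elim: k f a => [|k IH] f a hf.
  by exists M => h /hf; rewrite big_geq// subr0 expr0 mulr1.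
have f0 : f 0 = a 0%N.
  have := hf 0; rewrite cabs0 => /(_ r0).
  rewrite big_nat_recl//= expr0 mulr1 big1 ?addr0; last by move=> i _; rewrite expr0n/= mulr0.
  rewrite expr0n/= mulr0 => h; apply/eqP; rewrite -subr_eq0 -cabs_eq0 eq_le h.
  exact: cabs_ge0.
(* The estimate at 0 dictates this value: it must be [a 1] if a coefficient remains, and otherwise
   may be anything of modulus at most [M], here 0. *)
pose g h := if h == 0 then (if k is 0 then 0 else a 1%N) else (f h - a 0%N) / h.
have [N hN] : exists N, jet_le r k g N.
  apply: (IH _ (fun i => a i.+1)) => h hr; rewrite /g; case: eqP => [->|/eqP h0].
    case: k {hf IH g} => [|k]; first by rewrite big_geq// subrr cabs0 expr0 mulr1.
    rewrite big_nat_recl//= expr0 mulr1 big1; last by move=> i _; rewrite expr0n/= mulr0.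
    by rewrite addr0 subrr cabs0 mulr_ge0// exprn_ge0.
  have ch : 0 < cabs h by rewrite cabs_gt0.
  rewrite -(ler_pM2r ch) -cabsM -mulrA -exprSr; apply: le_trans (hf h hr).
  rewrite le_eqVlt; apply/orP; left; apply/eqP; congr cabs.
  rewrite mulrBl divfK// big_nat_recl//= expr0 mulr1 opprD addrA; congr (_ - _).
  by rewrite mulr_suml; apply: eq_bigr => i _; rewrite exprSr mulrA.
exists (cabs (a 0%N) + r * N), (a 0%N), g, N; split=> // h hr.
rewrite /g; case: eqP => [->|/eqP h0]; first by rewrite f0 mul0r addr0.
by rewrite mulrC divfK// addrC subrK.
Qed.

Lemma jet_cexp r k (c d : C) : 0 <= r -> exists N, jet_le r k (fun h => cexp (c + d * h)) N.
Proof.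
move=> r0.
have [||N hN] := @taylor_jet_le r k (fun h => cexp (d * h)) (fun i => (i`!%:R)^-1 * d ^+ i)
  (2 * expR (cabs d * r) * cabs d ^+ k) r0.
- by rewrite !mulr_ge0 ?exprn_ge0 ?cabs_ge0 ?expR_ge0.
- move=> h hr; have := cexp_taylor k (d * h).
  under eq_bigr do rewrite exprMn mulrA.
  move=> /le_trans; apply; rewrite cabsM exprMn mulrA ler_wpM2r ?exprn_ge0 ?cabs_ge0//.
  rewrite ler_wpM2r ?exprn_ge0 ?cabs_ge0// ler_wpM2l// ler_expR.
  by rewrite ler_wpM2l ?cabs_ge0.
- exists (cabs (cexp c) * N); apply: eq_jet_le (jet_leZ (cexp c) r0 hN) => h _.
  by rewrite cexpD.
Qed.

Lemma is_derive_cexp (p c : C) : is_derive p 1 (fun z => cexp (c * z)) (c * cexp (c * p)).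
Proof.
have [N [a0 [g [M [hg _ ef]]]]] := @jet_cexp 1 3 (c * p) c ler01.
have e0 : a0 = cexp (c * p).
  by have := ef 0; rewrite cabs0 => /(_ ler01); rewrite mulr0 mul0r !addr0.
have hd := @jet_le_is_derive R 1 1 (fun z => cexp (c * z)) M p a0 g ltr01 hg.
have {}hd := hd (fun h hr => etrans (congr1 cexp (mulrDr c p h)) (ef h hr)).
(* The jet gives the derivative only as [g 0]; the second-order Taylor bound identifies this value
   as the limit of the difference quotient. *)
have g0 : g 0 = c * cexp (c * p).
  have cg := @jet_le_cvg0 R 1 1 g M ltr01 hg.
  apply: dnbhs_cvg_unique (cvg_nbhs_dnbhs cg) _.
  apply/cvg_dnbhs_cabs => e e0'.
  pose K := cabs (cexp (c * p)) * (2 * expR (cabs c) * cabs c ^+ 2) + 1.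
  have K0 : 0 < K.
    by rewrite ltr_wpDl// !mulr_ge0 ?exprn_ge0 ?cabs_ge0 ?expR_ge0.
  exists (Num.min 1 (e / K)); first by rewrite lt_min ltr01 divr_gt0.
  move=> h; rewrite subr0 lt_min => /andP[h1 he] h0.
  have := ef h (ltW h1); rewrite cexpD e0 => eh.
  have -> : g h - c * cexp (c * p) = cexp (c * p) * (cexp (c * h) - 1 - c * h) / h.
    have -> : g h = (cexp (c * p) * cexp (c * h) - cexp (c * p)) / h.
      by rewrite eh addrC addKr mulrC mulKf.
    by field.
  rewrite cabsM cabsV cabsM ltr_pdivrMr ?cabs_gt0//.
  have := cexp_taylor 2 (c * h).
  rewrite big_nat_recr//= big_nat1 expr0 expr1 !fact0 factS fact0 muln1 invr1 !mul1r.
  rewrite opprD addrA => ht.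
  have ch : 0 < cabs h by rewrite cabs_gt0.
  have hb : 2 * expR (cabs (c * h)) * cabs (c * h) ^+ 2 <=
            2 * expR (cabs c) * cabs c ^+ 2 * cabs h ^+ 2.
    rewrite cabsM exprMn mulrA ler_wpM2r ?exprn_ge0 ?cabs_ge0//.
    rewrite ler_wpM2r ?exprn_ge0 ?cabs_ge0// ler_wpM2l// ler_expR.
    by apply: ler_piMr; rewrite ?cabs_ge0// ltW.
  apply: le_lt_trans (ler_wpM2l (cabs_ge0 _) (le_trans ht hb)) _.
  rewrite ltr_pdivlMr// in he.
  apply: le_lt_trans (_ : cabs h * K * cabs h < _); last by rewrite ltr_pM2r.
  rewrite /K; have := sqr_ge0 (cabs h); rewrite expr2; lra.
by rewrite -g0.
Qed.

End ComplexExp.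

(** * Powers of integers, and functions with jets of all orders *)

Section Npow.
Local Open Scope complex_scope.
Context {R : realType}.
Local Notation C := (Cplx R).
Implicit Types (n m : nat) (s t : C).

Lemma npowD n s t : npow n (s + t) = npow n s * npow n t.
Proof. by rewrite /npow mulrDl cexpD. Qed.

Lemma npowN n s : npow n (- s) = (npow n s)^-1.
Proof. by rewrite /npow mulNr cexpN. Qed.

Lemma npow_neq0 n s : npow n s != 0.
Proof. exact: cexp_neq0. Qed.

Lemma npow_nat n m : (0 < n)%N -> npow n (m%:R : C) = n%:R ^+ m.
Proof.
move=> n0; rewrite /npow cexpMn cexpR lnK ?rmorph_nat//.
by rewrite posrE ltr0n.
Qed.

Lemma npow_sub_nat n m s : (0 < n)%N -> npow n (s - m%:R) = npow n s / n%:R ^+ m.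
Proof. by move=> n0; rewrite npowD npowN npow_nat. Qed.

Lemma cabs_npow n s : cabs (npow n s) = expR (complex.Re s * ln (n%:R : R)).
Proof. by rewrite cabs_cexp ReM /= mulr0 subr0. Qed.

Lemma is_derive_npow n (p c : C) :
  is_derive p 1 (fun w => npow n (w + c)) ((ln (n%:R : R))%:C * npow n (p + c)).
Proof.
have -> : (fun w => npow n (w + c)) =
    npow n c \*: (fun w => cexp ((ln (n%:R : R))%:C * w)).
  apply/funext => w; rewrite npowD mulrC /GRing.scale/=; congr (_ * _).
  by rewrite /npow mulrC.
have h := is_derive_cexp p (ln (n%:R : R))%:C.
apply: is_derive_eq; rewrite /GRing.scale/= npowD mulrCA [npow n p * _]mulrC.
by rewrite /npow [p * _]mulrC.
Qed.

(** If [c = f p], a nearby solution of [f w = c] would make the difference quotient vanish, although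
    it stays within [|d|] of [d]; otherwise continuity of [f] suffices. This isolates the points
    where a denominator vanishes. *)
Lemma is_derive_near_neq (f : C -> C) (p d c : C) : is_derive p 1 f d -> d != 0 ->
  f w @[w --> p] --> f p -> \forall w \near p^', f w != c.
Proof.
move=> [fp dE] d0 hf.
have hc : h^-1 *: ((f \o shift p) (h *: (1 : C)) - f p) @[h --> (0 : C)^'] --> d.
  by rewrite -dE; exact: fp.
have [-> {c}|fc] := eqVneq c (f p).
  have /cvg_dnbhs_cabs/(_ (cabs d)) := hc; rewrite cabs_gt0 => /(_ d0)[e e0 he].
  apply/dnbhs_cabs; exists e => // w wp w0.
  have := he (w - p); rewrite subr0 subr_eq0 => /(_ wp w0).
  have sE (a b : C) : a *: b = a * b by [].
  rewrite /= !sE mulr1 subrK; apply: contraTneq => ->.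
  by rewrite subrr mulr0 sub0r cabsN ltxx.
have [e e0 he] : exists2 e : R, 0 < e &
    forall z, cabs (z - p) < e -> cabs (f z - f p) < cabs (c - f p).
  by have /cvg_nbhs_cabs := hf; apply; rewrite cabs_gt0 subr_eq0.
by apply/dnbhs_cabs; exists e => // w /he + _; apply: contraTneq => ->; rewrite ltxx.
Qed.

(** The working form of entire functions. Every order is required because a division by [h] consumes
    one; the radius 1 is a normalization. *)
Definition has_jets (f : C -> C) :=
  forall (p : C) (k : nat), exists M, jet_le 1 k (fun h => f (p + h)) M.

Lemma has_jets_cst (c : C) : has_jets (fun=> c).
Proof. by move=> p k; exists (cabs c); exact: jet_le_cst. Qed.

Lemma has_jetsD (f g : C -> C) : has_jets f -> has_jets g -> has_jets (fun s => f s + g s).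
Proof.
move=> hf hg p k; have [M hM] := hf p k; have [N hN] := hg p k.
by exists (M + N); exact: jet_leD.
Qed.

Lemma has_jetsM (f g : C -> C) : has_jets f -> has_jets g -> has_jets (fun s => f s * g s).
Proof.
move=> hf hg p k; have [M hM] := hf p k; have [N hN] := hg p k.
by exists (M * N); exact: jet_leM.
Qed.

Lemma has_jetsN (f : C -> C) : has_jets f -> has_jets (fun s => - f s).
Proof. by move=> hf p k; have [M hM] := hf p k; exists M; exact: jet_leN. Qed.

Lemma has_jets_sum (I : Type) (r : seq I) (P : pred I) (F : I -> C -> C) :
  (forall i, P i -> has_jets (F i)) -> has_jets (fun s => \sum_(i <- r | P i) F i s).
Proof.
move=> hF; elim: r => [|i r IH].
  by under eq_fun do rewrite big_nil; exact: has_jets_cst.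
under eq_fun do rewrite big_cons.
by case Pi: (P i); [exact: (has_jetsD (hF i Pi) IH)|exact: IH].
Qed.

Lemma has_jets_prod (I : Type) (r : seq I) (P : pred I) (F : I -> C -> C) :
  (forall i, P i -> has_jets (F i)) -> has_jets (fun s => \prod_(i <- r | P i) F i s).
Proof.
move=> hF; elim: r => [|i r IH].
  by under eq_fun do rewrite big_nil; exact: has_jets_cst.
under eq_fun do rewrite big_cons.
by case Pi: (P i); [exact: (has_jetsM (hF i Pi) IH)|exact: IH].
Qed.

Lemma has_jets_shift (f : C -> C) (c : C) : has_jets f -> has_jets (fun s => f (s + c)).
Proof.
move=> hf p k; have [M hM] := hf (p + c) k; exists M.
by apply: eq_jet_le hM => h _; rewrite addrAC.
Qed.

Lemma has_jets_npow n c : has_jets (fun s => npow n (s + c)).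
Proof.
move=> p k; have [M hM] := @jet_cexp R 1 k ((p + c) * (ln n%:R)%:C) (ln n%:R)%:C ler01.
by exists M; apply: eq_jet_le hM => h _; rewrite /npow; congr cexp; ring.
Qed.

Lemma has_jets_npowN n c : has_jets (fun s => npow n (- s + c)).
Proof.
move=> p k; have [M hM] := @jet_cexp R 1 k ((- p + c) * (ln n%:R)%:C) (- (ln n%:R)%:C) ler01.
exists M; apply: eq_jet_le hM => h _.
by rewrite /npow; congr cexp; ring.
Qed.

Lemma has_jets_entire (f : C -> C) : has_jets f -> entire f.
Proof. by move=> hf p; have [M /jet_le_derivable] := hf p 2; apply. Qed.

Lemma has_jets_cvg (f : C -> C) (p : C) : has_jets f -> f w @[w --> p] --> f p.
Proof. by move=> hf; have [M hM] := hf p 1%N; apply: jet_le_cvg hM. Qed.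

(** Continuity does the work of the identity theorem, as the identities to be extended hold off
    isolated points. *)
Lemma has_jets_dnbhs_eq (f g : C -> C) (p : C) : has_jets f -> has_jets g ->
  (\forall w \near p^', f w = g w) -> f p = g p.
Proof.
move=> /(has_jets_cvg (p := p))/cvg_nbhs_dnbhs hf /(has_jets_cvg (p := p))/cvg_nbhs_dnbhs hg.
move=> /dnbhs_cabs[d d0 hd]; apply: dnbhs_cvg_unique hf _.
apply/cvg_dnbhs_cabs => e e0; have /cvg_dnbhs_cabs/(_ e e0)[d' d'0 hd'] := hg.
exists (Num.min d d'); first by rewrite lt_min d0.
by move=> z; rewrite lt_min => /andP[zd zd'] zp; rewrite hd//; exact: hd'.
Qed.

End Npow.

(** * Infinite products *)

Section InfiniteProduct.
Local Open Scope complex_scope.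
Context {R : realType}.
Local Notation C := (Cplx R).
Implicit Types (x : nat -> C -> C) (M : nat -> R) (r B : R) (k : nat).

Lemma prod_le_expR M n : (forall i, 0 <= M i) ->
  \prod_(0 <= i < n) (1 + M i) <= expR (series M n).
Proof.
move=> M0; rewrite seriesE.
elim: n => [|n IH]; first by rewrite !big_geq// expR0.
rewrite !big_nat_recr//= expRD; apply: ler_pM => //.
- by rewrite prodr_ge0// => i _; rewrite addr_ge0.
- by rewrite addr_ge0.
- exact: expR_ge1Dx.
Qed.

(** The partial products telescope: [P n] is 1 minus the sum of [P m * x m] over [m < n]. Since
    [P m] is bounded by [expR B], the product becomes a series dominated by [expR B * M m]. *)
Lemma jet_le_iprod r k x M B : 0 < r -> (forall n, jet_le r k (x n) (M n)) ->
  (forall n, series M n <= B) ->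
  (exists N, jet_le r k (fun h => limn (fun n => \prod_(0 <= i < n) (1 - x i h))) N) /\
  (forall h, cabs h <= r -> cvgn (fun n => \prod_(0 <= i < n) (1 - x i h))).
Proof.
move=> r_gt0 hx hB; have r0 := ltW r_gt0.
have M0 n : 0 <= M n := jet_le_ge0 r0 (hx n).
pose P n h := \prod_(0 <= i < n) (1 - x i h).
have hP n : jet_le r k (P n) (expR B).
  apply: (@jet_le_trans _ _ _ _ (\prod_(0 <= i < n) (1 + M i))); last first.
    by apply: le_trans (prod_le_expR _ M0) _; rewrite ler_expR.
  apply: jet_le_prod => // i _; apply: jet_leD => //; last exact: jet_leN.
  by rewrite -(@cabs1 R); exact: jet_le_cst.
have hf n : jet_le r k (fun h => - (P n h * x n h)) (expR B * M n).
  by apply: jet_leN => //; exact: jet_leM.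
have hS n : series (fun n => expR B * M n) n <= expR B * B.
  by rewrite seriesE -mulr_sumr ler_wpM2l ?expR_ge0//; exact: hB.
have eP h : (fun n => P n h) = (fun n => 1 + series (fun m => - (P m h * x m h)) n).
  apply/funext; elim=> [|n IH]; first by rewrite /P /series/= !big_geq// addr0.
  rewrite seriesE big_nat_recr//= addrA -[X in 1 + X]seriesE -IH.
  by rewrite /P big_nat_recr//= mulrBr mulr1.
have hc h : cabs h <= r -> P n h @[n --> \oo] --> 1 + limn (series (fun m => - (P m h * x m h))).
  move=> hr; rewrite eP; apply: cvgD; first exact: cvg_cst.
  exact: jet_le_cvg_series hf hS hr.
split=> [|h /hc h']; last by apply/cvg_ex; exists (1 + limn (series (fun m => - (P m h * x m h)))).
have [N hN] := jet_le_series r_gt0 hf hS.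
exists (cabs 1 + N); apply: eq_jet_le (jet_leD r0 (jet_le_cst k 1 r0) hN) => h hr.
by rewrite -(cvg_lim _ (hc h hr)).
Qed.

(** By induction the partial products have modulus at least 1 minus the sum of the [|x i|], hence at
    least [1 / 2], and this passes to the limit. *)
Lemma iprod_neq0 (x : nat -> C) : (forall n, \sum_(0 <= i < n) cabs (x i) <= 2^-1) ->
  cvgn (fun n => \prod_(0 <= i < n) (1 - x i)) ->
  limn (fun n => \prod_(0 <= i < n) (1 - x i)) != 0.
Proof.
move=> hx hc.
have key n : 1 - \sum_(0 <= i < n) cabs (x i) <= cabs (\prod_(0 <= i < n) (1 - x i)).
  elim: n => [|n IH]; first by rewrite !big_geq// cabs1 subr0.
  rewrite !big_nat_recr//= cabsM.
  have h1 : 1 - cabs (x n) <= cabs (1 - x n) by have := cabs_subD 1 (x n); rewrite cabs1.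
  have h2 := hx n; have h3 := hx n.+1; rewrite big_nat_recr//= in h3.
  have h4 := cabs_ge0 (x n).
  have h5 : 0 <= \sum_(0 <= i < n) cabs (x i) by apply: sumr_ge0 => i _; exact: cabs_ge0.
  apply: le_trans (_ : (1 - \sum_(0 <= i < n) cabs (x i)) * (1 - cabs (x n)) <= _).
    by have := mulr_ge0 h4 h5; lra.
  by apply: ler_pM => //; lra.
have h : cabs (\prod_(0 <= i < n) (1 - x i)) @[n --> \oo] -->
   cabs (limn (fun n => \prod_(0 <= i < n) (1 - x i))) by exact: cvg_cabs_lim.
rewrite -cabs_gt0; apply: (@lt_le_trans _ _ (2^-1)) => //.
apply: (cvgr_to_ge h); apply: nearW => n.
by have := key n; have := hx n; lra.
Qed.

End InfiniteProduct.

(** * The function alpha *)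

Section Alpha.
Local Open Scope complex_scope.
Context {R : realType} (b : nat) (A : {set 'I_b}) (hb : (1 < b)%N).
Local Notation C := (Cplx R).
Implicit Types (s p w : C) (n m j k : nat).

Let N : C := #|A|%:R.

Definition alpha_factor n s : C := npow b (- s - n%:R) * N.
Local Notation xf := alpha_factor.

Let b0 : (0 < b)%N := ltnW hb.

Lemma alpha_factorE n s : xf n s = npow b (- s) * N / b%:R ^+ n.
Proof. by rewrite /xf npow_sub_nat// mulrAC. Qed.

Lemma alpha_factor_shift n j s : xf n (s + j%:R) = xf (j + n)%N s.
Proof. by rewrite /xf opprD natrD opprD addrA. Qed.

Lemma sub1_alpha_factor n s : 1 - xf n s = npow b (- s - n%:R) * (npow b (s + n%:R) - N).
Proof.
rewrite mulrBr -npowD; have -> : - s - n%:R + (s + n%:R) = 0 by ring.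
by have -> : npow b (0 : C) = 1 by rewrite /npow mul0r cexp0.
Qed.

Lemma sub1_alpha_factor_eq0 n s : (1 - xf n s == 0) = (npow b (s + n%:R) == N).
Proof. by rewrite sub1_alpha_factor mulf_eq0 (negPf (npow_neq0 _ _)) subr_eq0. Qed.

Lemma geometric_bound (X : R) n : 0 <= X -> series (fun i => X / b%:R ^+ i) n <= X * 2.
Proof.
move=> X0; rewrite seriesE -mulr_sumr ler_wpM2l//.
(* The added term [2 / b ^ n] is at least the missing tail, because [b >= 2]; with it the induction
   goes through. *)
suff : \sum_(0 <= i < n) (b%:R ^+ i)^-1 + 2 / b%:R ^+ n <= 2 :> R.
  by apply: le_trans; rewrite lerDl divr_ge0// exprn_ge0.
elim: n => [|n IH]; first by rewrite big_geq// expr0 divr1 add0r.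
rewrite big_nat_recr//=; apply: le_trans IH; rewrite -addrA lerD2l.
rewrite exprS invfM; have : 0 <= (b%:R ^+ n)^-1 :> R by rewrite invr_ge0 exprn_ge0.
have : 2 / b%:R <= 1 :> R.
  by rewrite ler_pdivrMr ?mul1r ?ler_nat// ltr0n.
by set x := _^-1; set y := _^-1 => hx hy; nra.
Qed.

Lemma jet_alpha_factor p k : exists2 X : R, 0 <= X &
  forall n, jet_le 1 k (fun h => xf n (p + h)) (X / b%:R ^+ n).
Proof.
have hN : has_jets (fun s : C => npow b (- s)).
  move=> q j; have [M hM] := @has_jets_npowN R b 0 q j.
  by exists M; apply: eq_jet_le hM => h _; rewrite addr0.
have [M hM] := has_jetsM hN (has_jets_cst N) p k.
exists M; first exact: jet_le_ge0 hM.
move=> n; have := jet_leZ (b%:R ^+ n)^-1 ler01 hM.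
rewrite cabsV cabsX cabs_nat mulrC; apply: eq_jet_le => h _.
by rewrite alpha_factorE mulrC.
Qed.

Lemma alpha_prod_cvg (s : C) : cvgn (fun n => \prod_(0 <= i < n) (1 - xf i s)).
Proof.
have [X X0 hX] := jet_alpha_factor s 0.
have [_ /(_ 0)] := jet_le_iprod ltr01 hX (fun n => geometric_bound n X0).
by rewrite cabs0 addr0; apply; exact: ler01.
Qed.

Lemma alpha_has_jets : has_jets (alpha A : C -> C).
Proof.
move=> p k; have [X X0 hX] := jet_alpha_factor p k.
by have [] := jet_le_iprod ltr01 hX (fun n => geometric_bound n X0).
Qed.

Lemma alpha_split J s :
  alpha A s = \prod_(0 <= i < J) (1 - xf i s) * alpha A (s + J%:R).
Proof.
have h : \prod_(0 <= i < J) (1 - xf i s) * \prod_(0 <= i < n) (1 - xf i (s + J%:R))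
    @[n --> \oo] --> \prod_(0 <= i < J) (1 - xf i s) * alpha A (s + J%:R).
  by apply: cvgMl_tmp; exact: alpha_prod_cvg.
rewrite -(cvgn_limE h); apply/esym; apply: cvgn_limE.
have -> : (fun n => \prod_(0 <= i < J) (1 - xf i s) *
   \prod_(0 <= i < n) (1 - xf i (s + J%:R))) =
   (fun n => \prod_(0 <= i < n + J) (1 - xf i s)).
  apply/funext => n; rewrite (@big_cat_nat _ _ _ J 0 (n + J)%N)//= ?leq_addl//.
  congr (_ * _); rewrite -{2}[J]add0n big_addn addnK.
  by apply: eq_bigr => i _; rewrite alpha_factor_shift addnC.
have := @alpha_prod_cvg s; rewrite -(@cvg_shiftn J) => hc.
exact: hc.
Qed.

Lemma alpha_tail_neq0 s : exists J : nat, alpha A (s + J%:R) != 0.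
Proof.
have [X X0 hX] := jet_alpha_factor s 0.
(* The factors from index [J] on are bounded by [X / b ^ J] times a geometric series of sum at most
   2; the constant 4 brings the total down to [1 / 2], as [iprod_neq0] asks. *)
have [J hJ] : exists J : nat, X * 4 <= b%:R ^+ J.
  exists (Num.truncn (X * 4)).+1; apply: le_trans (ltW (truncnS_gt _)) _.
  by rewrite -natrX ler_nat; apply: ltnW; exact: ltn_expl.
exists J; apply: iprod_neq0 (@alpha_prod_cvg _) => n.
have bJ : 0 < b%:R ^+ J :> R by rewrite exprn_gt0// ltr0n.
apply: (@series_dominated R (fun i => xf i (s + J%:R)) (fun i => (X / b%:R ^+ J) / b%:R ^+ i)).
  move=> i; have := jet_le_bound ler01 (hX (J + i)%N) (h := 0).
  rewrite cabs0 addr0 alpha_factor_shift => /(_ ler01); rewrite exprD invfM mulrA.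
  by [].
move=> k; apply: le_trans (geometric_bound k _) _; first by rewrite divr_ge0// ltW.
by rewrite mulrAC ler_pdivrMr//; move: hJ; lra.
Qed.

Lemma alpha_eq0 s : alpha A s = 0 -> exists n, npow b (s + n%:R) = N.
Proof.
have [J hJ] := alpha_tail_neq0 s; rewrite (alpha_split J) => /eqP.
rewrite mulf_eq0 (negPf hJ) orbF big_mkord prodf_seq_eq0 => /hasP[i _ /=].
by rewrite sub1_alpha_factor_eq0 => /eqP h; exists i.
Qed.

Lemma npow_shift_inj s n m : npow b (s + n%:R) = npow b (s + m%:R) -> n = m.
Proof.
rewrite !npowD !npow_nat// => /(mulfI (npow_neq0 _ _)) /eqP.
rewrite -!natrX eqr_nat eqn_exp2l//.
by move/eqP.
Qed.

Lemma npow_near_neq m s : \forall w \near s^', npow b (w + m%:R) != N.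
Proof.
have h := @is_derive_near_neq R (fun w => npow b (w + m%:R)) s _ N (is_derive_npow b s m%:R).
apply: h.
  rewrite mulf_neq0 ?npow_neq0// -cabs_eq0 cabsR normr_eq0 gt_eqF//.
  by rewrite ln_gt0// ltr1n.
exact: has_jets_cvg (has_jets_npow b m%:R).
Qed.

Lemma npow_near_neq_le m s :
  \forall w \near s^', forall j, (j <= m)%N -> npow b (w + j%:R) != N.
Proof.
elim: m => [|m /dnbhs_cabs[d d0 hd]].
  have /dnbhs_cabs[d d0 hd] := npow_near_neq 0 s.
  by apply/dnbhs_cabs; exists d => // w wd ws j; rewrite leqn0 => /eqP ->; exact: hd.
have /dnbhs_cabs[d' d'0 hd'] := npow_near_neq m.+1 s.
apply/dnbhs_cabs; exists (Num.min d d'); first by rewrite lt_min d0.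
move=> w; rewrite lt_min => /andP[wd wd'] ws j.
rewrite leq_eqVlt => /predU1P[->|]; first exact: hd'.
by rewrite ltnS; exact: hd.
Qed.

(* The zeros of the factors are simple and no two factors share a zero. *)
Lemma alpha_simple_zero p k g c M : alpha A p = 0 -> jet_le 1 k.+1 g M ->
  (forall h, cabs h <= 1 -> alpha A (p + h) = c + h * g h) -> c = 0 /\ g 0 != 0.
Proof.
move=> ap0 hg eg.
have c0 : c = 0.
  have := eg 0; rewrite cabs0 => /(_ ler01).
  by rewrite !addr0 ap0 mul0r addr0 => <-.
split=> //; have [n hn] := alpha_eq0 ap0; have [J hJ] := alpha_tail_neq0 p.
(* Otherwise the vanishing factor would belong to the tail [alpha A (p + J%:R)], which is not 0. *)
have nJ : (n < J)%N.
  rewrite ltnNge; apply: contra hJ => Jn.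
  rewrite (alpha_split (n - J).+1) big_nat_recr//= alpha_factor_shift subnKC//.
  have /eqP -> : 1 - xf n p == 0 by rewrite sub1_alpha_factor_eq0 hn.
  by rewrite mulr0 mul0r.
(* The cofactor of [npow b (s + n%:R) - N] in [alpha]; it does not vanish at [p], since no other
   factor does. *)
pose beta s := npow b (- s - n%:R) * (\prod_(0 <= i < n) (1 - xf i s) *
   (\prod_(n.+1 <= i < J) (1 - xf i s) * alpha A (s + J%:R))).
have xfj i : has_jets (fun s => 1 - xf i s).
  apply: has_jetsD; first exact: has_jets_cst.
  apply: has_jetsN; apply: has_jetsM; first exact: has_jets_npowN.
  exact: has_jets_cst.
have betaj : has_jets beta.
  apply: has_jetsM; first exact: has_jets_npowN.
  apply: has_jetsM; first by apply: has_jets_prod => i _.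
  apply: has_jetsM; first by apply: has_jets_prod => i _.
  by apply: has_jets_shift; exact: alpha_has_jets.
have beta0 : beta p != 0.
  have hi i : i != n -> 1 - xf i p != 0.
    by rewrite sub1_alpha_factor_eq0 -hn; apply: contra => /eqP/npow_shift_inj ->.
  apply: mulf_neq0; first exact: npow_neq0.
  apply: mulf_neq0.
    rewrite prodf_seq_neq0; apply/allP => i; rewrite mem_index_iota => /andP[_ hin] /=.
    by apply: hi; rewrite ltn_eqF.
  apply: mulf_neq0; last exact: hJ.
  rewrite prodf_seq_neq0; apply/allP => i; rewrite mem_index_iota => /andP[hin _] /=.
  by apply: hi; rewrite gtn_eqF.
have aE s : alpha A s = (npow b (s + n%:R) - N) * beta s.
  have e2 : \prod_(0 <= i < J) (1 - xf i s) = \prod_(0 <= i < n) (1 - xf i s) *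
      ((1 - xf n s) * \prod_(n.+1 <= i < J) (1 - xf i s)).
    by rewrite -big_ltn// -big_cat_nat// ltnW.
  rewrite (alpha_split J s) e2 sub1_alpha_factor /beta.
  move: (npow b (- s - n%:R)) (npow b (s + n%:R) - N) (alpha A (s + J%:R)).
  move: (\prod_(0 <= i < n) _) (\prod_(n.+1 <= i < J) _) => x y z t v.
  by rewrite !mulrA [t * z]mulrC (mulrC x) -!mulrA; congr (_ * _); rewrite mulrCA.
have [K [c1 [e [K' [he _ ee]]]]] :=
  @has_jetsD R _ _ (has_jets_npow b n%:R) (has_jets_cst (- N)) p k.+2.
have {}he : jet_le 1 k.+1 e K' := he.
have c10 : c1 = 0.
  have := ee 0; rewrite cabs0 => /(_ ler01).
  by rewrite !addr0 hn subrr mul0r addr0 => <-.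
have e0 : e 0 != 0.
  have d1 := @jet_le_is_derive R 1 k (fun w => npow b (w + n%:R) - N) K' p c1 e ltr01 he ee.
  have d2 : is_derive p 1 (fun w => npow b (w + n%:R) - N)
     ((ln (b%:R : R))%:C * npow b (p + n%:R)).
    have h := is_derive_npow b p n%:R.
    by have := is_deriveB h (is_derive_cst N p 1); rewrite subr0.
  have -> : e 0 = (ln (b%:R : R))%:C * npow b (p + n%:R).
    by rewrite -(@derive_val _ _ _ _ _ _ _ d1) (@derive_val _ _ _ _ _ _ _ d2).
  rewrite mulf_neq0 ?npow_neq0// -cabs_eq0 cabsR normr_eq0 gt_eqF//.
  by rewrite ln_gt0// ltr1n.
(* For small [h != 0], cancelling [h] in the two expressions of [alpha A (p + h)] gives
   [g h = e h * beta (p + h)]; continuity carries this to [h = 0]. *)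
have -> : g 0 = e 0 * beta p; last by rewrite mulf_neq0.
have cg := cvg_nbhs_dnbhs (jet_le_cvg0 ltr01 hg).
apply: dnbhs_cvg_unique cg _.
have [Mb hMb] := betaj p k.+1.
have heb := jet_leM ler01 he hMb.
have := cvg_nbhs_dnbhs (jet_le_cvg0 ltr01 heb); rewrite addr0.
move=> /cvg_dnbhs_cabs hc; apply/cvg_dnbhs_cabs => eps /hc[d d0 hd].
exists (Num.min d 1); first by rewrite lt_min d0 ltr01.
move=> h; rewrite lt_min => /andP[hhd h1] h0.
have -> : g h = e h * beta (p + h); last exact: hd.
apply: (mulfI h0); have h1' : cabs h <= 1 by rewrite subr0 in h1; exact: ltW.
have := eg _ h1'; rewrite c0 add0r => <-.
have e3 : npow b (p + h + n%:R) - N = h * e h by have := ee h h1'; rewrite c10 add0r.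
by rewrite aE e3 -mulrA.
Qed.

End Alpha.

(** * Geometric growth estimates *)

Section Growth.
Local Open Scope complex_scope.
Context {R : realType}.
Implicit Types (a : nat -> R) (q K : R).

Lemma geometric_small K q : 0 <= K -> 0 <= q < 1 ->
  exists m0, forall m, (m0 <= m)%N -> K * q ^+ m <= 1.
Proof.
move=> K0 /andP[q0 q1].
have h : K * q ^+ m @[m --> \oo] --> K * 0.
  by apply: cvgMl_tmp; apply: cvg_expr; rewrite ger0_norm.
rewrite mulr0 in h.
have [m0 _ hm] := cvgr_le _ h _ ltr01.
by exists m0 => m /hm.
Qed.

Lemma geometric_sum_le q n : 0 <= q < 1 -> \sum_(0 <= i < n) q ^+ i <= (1 - q)^-1.
Proof.
move=> /andP[q0 q1].
suff : \sum_(0 <= i < n) q ^+ i + q ^+ n / (1 - q) <= (1 - q)^-1.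
  by apply: le_trans; rewrite lerDl divr_ge0// ?exprn_ge0// subr_ge0 ltW.
elim: n => [|n IH]; first by rewrite big_geq// expr0 add0r mul1r.
rewrite big_nat_recr//=; apply: le_trans IH; rewrite -addrA lerD2l.
rewrite le_eqVlt; apply/orP; left; apply/eqP; rewrite exprS.
by field; rewrite subr_eq0 gt_eqF.
Qed.

Lemma ratio_bound a q m0 : (forall m, 0 <= a m) -> 0 < q ->
  (forall m, (m0 <= m)%N -> a m.+1 <= q * a m) ->
  exists2 K, 0 <= K & forall m, a m <= K * q ^+ m.
Proof.
move=> a0 q0 ha; pose K := \sum_(0 <= i < m0.+1) a i / q ^+ i.
have K0 : 0 <= K by apply: sumr_ge0 => i _; rewrite divr_ge0// exprn_ge0// ltW.
exists K => //; have small m : (m <= m0)%N -> a m <= K * q ^+ m.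
  move=> mm; rewrite -ler_pdivrMr ?exprn_gt0// /K (bigD1_seq m) ?mem_index_iota ?iota_uniq//=.
  rewrite lerDl; apply: sumr_ge0 => i _; rewrite divr_ge0// exprn_ge0// ltW//.
elim=> [|m IH]; first exact: small.
have [/small//|mm] := leqP m.+1 m0.
apply: le_trans (ha m mm) _; rewrite exprS mulrCA ler_wpM2l// ltW//.
Qed.

(** The ratio of consecutive terms is [3 / 4 * (1 + c / (m + 1))], at most [7 / 8] once
    [6 * c <= m + 1]. The factors are [c + i + 1] rather than [c + i] to leave room for a disc of
    radius 1 about a point of modulus [c]. *)
Lemma rising_bound (c : R) : 0 <= c -> exists2 K, 0 <= K &
  forall m, \prod_(0 <= i < m) (c + i%:R + 1) / m`!%:R * (3 / 4) ^+ m <= K * (7 / 8) ^+ m.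
Proof.
move=> c0.
pose a m := \prod_(0 <= i < m) (c + i%:R + 1) / m`!%:R * (3 / 4) ^+ m.
apply: (@ratio_bound a _ (Num.truncn (6 * c)).+1) => [m||m hm]; last 1 first.
- have hc : 6 * c <= m.+1%:R.
    apply: le_trans (ltW (truncnS_gt _)) _; rewrite ler_nat; exact: leqW.
  have -> : a m.+1 = ((c + m%:R + 1) / m.+1%:R * (3 / 4)) * a m.
    rewrite /a big_nat_recr//= factS natrM exprS.
    have : (m`!%:R : R) != 0 by rewrite pnatr_eq0 -lt0n fact_gt0.
    have : (m.+1%:R : R) != 0 by rewrite pnatr_eq0.
    move: (\prod_(_ <= _ < _) _) (m.+1%:R : R) (m`!%:R : R) => x y z y0 z0.
    by field; rewrite y0 z0.
  have a0 : 0 <= a m.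
    rewrite /a mulr_ge0 ?exprn_ge0// mulr_ge0 ?invr_ge0//.
    by apply: prodr_ge0 => i _; rewrite !addr_ge0.
  apply: ler_wpM2r => //; rewrite mulrAC ler_pdivrMr//.
  have e : m.+1%:R = m%:R + 1 :> R by rewrite natr1.
  by rewrite e in hc *; lra.
- rewrite /a mulr_ge0 ?exprn_ge0// mulr_ge0 ?invr_ge0//.
  by apply: prodr_ge0 => i _; rewrite !addr_ge0.
- by [].
Qed.

Lemma cabs_pochhammer (s : Cplx R) m :
  cabs (pochhammer s m) <= \prod_(0 <= i < m) (cabs s + i%:R + 1).
Proof.
rewrite /pochhammer cabs_prod; apply: ler_prod => i _.
rewrite cabs_ge0/=; apply: le_trans (cabsD _ _) _.
by rewrite cabs_nat lerDl.
Qed.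

End Growth.

(** * The entire functions alpha * u_m and the series *)

Section AlphaU.
Local Open Scope complex_scope.
Context {R : realType} (b : nat) (A : {set 'I_b}) (hb : (1 < b)%N).
Local Notation C := (Cplx R).
Implicit Types (s p w : C) (n m j k : nat).

Let N : C := #|A|%:R.
Local Notation xf := (@alpha_factor R b A).

Let b0 : (0 < b)%N := ltnW hb.

(** The points at which the values [u 0], ..., [u m] involve no division by zero. *)
Definition regular_upto m w := forall j, (j <= m)%N -> npow b (w + j%:R) != N.

Lemma regular_uptoW m k w : (k <= m)%N -> regular_upto m w -> regular_upto k w.
Proof. by move=> km h j jk; apply: h; exact: leq_trans km. Qed.

Lemma has_jets_sub1_factor i : has_jets (fun s => 1 - xf i s).
Proof.
apply: has_jetsD; first exact: has_jets_cst.
apply: has_jetsN; apply: has_jetsM; first exact: has_jets_npowN.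
exact: has_jets_cst.
Qed.

Lemma has_jets_sum_nat n m (F : nat -> C -> C) :
  (forall i, (n <= i < m)%N -> has_jets (F i)) ->
  has_jets (fun s => \sum_(n <= i < m) F i s).
Proof.
move=> hF; have -> : (fun s => \sum_(n <= i < m) F i s) =
    (fun s => \sum_(n <= i < m | (n <= i < m)%N) F i s).
  by apply/funext => s; rewrite big_nat.
exact: has_jets_sum.
Qed.

(* Multiplying [u A k w] by the first [k.+1] factors of [alpha A w] clears the
   denominators produced by the recursion. *)
Lemma exists_numerators m : exists P : nat -> C -> C, forall k, (k <= m)%N ->
  has_jets (P k) /\ forall w, regular_upto k w ->
  (\prod_(0 <= i < k.+1) (1 - xf i w)) * u A k w = P k w.
Proof.
elim: m => [|m [P hP]].
  exists (fun _ _ => 1) => k; rewrite leqn0 => /eqP ->; split; first exact: has_jets_cst.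
  move=> w /(_ 0%N (leqnn _)); rewrite addr0 -subr_eq0 => nz.
  rewrite big_nat1 u0E sub1_alpha_factor// subr0 addr0 npowN.
  by field; rewrite nz npow_neq0.
(* The last factor is [npow b (- w - m.+1%:R)] times the divisor in the recursion for [u m.+1]. Each
   [u (m.+1 - j)] absorbs the factors that clear its own denominators, and the others remain as a
   product. *)
pose Q w := npow b (- w - m.+1%:R) * \sum_(1 <= j < m.+2) ('C(m.+1, j))%:R * gamma A j *
   (P (m.+1 - j)%N w * \prod_((m.+1 - j).+1 <= i < m.+1) (1 - xf i w)).
exists (fun k => if k == m.+1 then Q else P k) => k.
case: eqVneq => [->|km]; last first.
  by rewrite leq_eqVlt (negPf km) ltnS; exact: hP.
move=> _; split.
  apply: has_jetsM; first exact: has_jets_npowN.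
  have jb j : (0 < j)%N -> (m.+1 - j <= m)%N by case: j => // j _; rewrite subSS leq_subr.
  apply: has_jets_sum_nat => j /andP[j0 _].
  apply: has_jetsM; first exact: has_jets_cst.
  apply: has_jetsM; first exact: (hP _ (jb j j0)).1.
  by apply: has_jets_prod => i _; exact: has_jets_sub1_factor.
move=> w hw.
rewrite big_nat_recr//= -mulrA sub1_alpha_factor// -mulrA.
rewrite (@u_rec R b A m.+1 w) ?hw// mulrCA; congr (_ * _).
rewrite mulr_sumr; apply: eq_big_nat => j /andP[j0 jm].
have jm' : (m.+1 - j <= m)%N by case: j j0 {jm} => // j _; rewrite subSS leq_subr.
rewrite mulrCA; congr (_ * _).
rewrite -(hP _ jm').2; last by apply: regular_uptoW hw; exact: leqW.
by rewrite (@big_cat_nat _ _ _ (m.+1 - j).+1)//= mulrAC.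
Qed.

(** The product [V] of a numerator and the tail of [alpha] is continuous and equals [alpha * u m] at
    regular points, which fill a punctured disc about any [s]. Hence [V] is the limit defining
    [alpha_u], at the poles of [u m] as well. *)
Lemma alpha_uP m : [/\ has_jets (alpha_u A m : C -> C) &
  forall w, regular_upto m w -> alpha_u A m w = alpha A w * u A m w].
Proof.
have [P /(_ m (leqnn m))[Pj hP]] := exists_numerators m.
pose V w := P m w * alpha A (w + m.+1%:R).
have Vj : has_jets V.
  by apply: has_jetsM => //; apply: has_jets_shift; exact: alpha_has_jets.
have VE w : regular_upto m w -> alpha A w * u A m w = V w.
  by move=> hw; rewrite (alpha_split A hb m.+1) mulrAC hP.
have uV s : alpha_u A m s = V s.
  apply: dnbhs_cvg_lim; have /cvg_nbhs_dnbhs/cvg_dnbhs_cabs h := has_jets_cvg (p := s) Vj.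
  apply/cvg_dnbhs_cabs => e /h[d d0 hd].
  have /dnbhs_cabs[d' d'0 hd'] := npow_near_neq_le A hb m s.
  exists (Num.min d d'); first by rewrite lt_min d0.
  move=> z; rewrite lt_min => /andP[zd zd'] zs.
  by rewrite VE; [exact: hd|exact: hd'].
split=> [|w hw]; last by rewrite uV VE.
by have -> : (alpha_u A m : C -> C) = V by exact/funext.
Qed.

(** With the divisor kept on the left, both sides have jets, so the recursion extends by continuity
    to the points where some [npow b (s + j%:R) = N]. *)
Lemma alpha_u_rec m s : (0 < m)%N ->
  (npow b (s + m%:R) - N) * alpha_u A m s =
  \sum_(1 <= j < m.+1) ('C(m, j))%:R * gamma A j * alpha_u A (m - j) s.
Proof.
move=> m0.
pose f s := (npow b (s + m%:R) - N) * alpha_u A m s.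
pose g s := \sum_(1 <= j < m.+1) ('C(m, j))%:R * gamma A j * alpha_u A (m - j) s.
apply: (@has_jets_dnbhs_eq R f g).
- apply: has_jetsM; last by have [] := alpha_uP m.
  by apply: has_jetsD; [exact: has_jets_npow|exact: has_jets_cst].
- apply: has_jets_sum => j _; apply: has_jetsM; first exact: has_jets_cst.
  by have [] := alpha_uP (m - j).
have /dnbhs_cabs[d d0 hd] := npow_near_neq_le A hb m s.
apply/dnbhs_cabs; exists d => // w wd ws; have hw := hd _ wd ws.
have hk k : (k <= m)%N -> alpha_u A k w = alpha A w * u A k w.
  by move=> km; have [_] := alpha_uP k; apply; apply: regular_uptoW hw.
rewrite /f hk// mulrCA u_rec ?hw// mulr_sumr; apply: eq_bigr => j _.
by rewrite hk ?leq_subr// mulrCA.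
Qed.

Lemma gamma_le j : cabs (gamma A j : C) <= #|A|%:R * (b%:R - 1) ^+ j.
Proof.
apply: le_trans (cabs_sum _ _ _) _.
rewrite mulr_natl -sumr_const; apply: ler_sum => a _.
rewrite cabsX cabs_nat lerXn2r ?nnegrE ?ler0n ?subr_ge0 ?ler1n//.
by rewrite lerBrDr natr1 ler_nat ltn_ord.
Qed.

(* With [t = 3 / 2], any number strictly between [1] and [b], the recursion
   preserves the bound [K * t ^+ m] as soon as [m] is large, because
   [(t + b - 1) / (b * t) <= 5 / 6 < 1]; and [t / b <= 3 / 4] leaves room for
   the geometric convergence of the main series. *)
Lemma jet_alpha_u p k : exists2 K : R, 0 <= K &
  forall m, jet_le 1 k (fun h => alpha_u A m (p + h)) (K * (3 / 2) ^+ m).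
Proof.
have [X X0 hX] := jet_alpha_factor A hb p k.
have [Y hY] : exists Y, jet_le 1 k (fun h => npow b (- (p + h) + 0)) Y.
  exact: has_jets_npowN.
have Y0 := jet_le_ge0 ler01 hY.
have q56 : 0 <= (5 / 6 : R) < 1.
  by apply/andP; split; lra.
have XY0 : 0 <= 2 * X + 2 * Y * #|A|%:R by rewrite addr_ge0 ?mulr_ge0.
(* One inequality serves twice: the part with [X] keeps the factor [xf m] below [1 / 2], so that the
   inverse of [1 - xf m] is at most 2; the part with [Y] is the gain in the recursion. *)
have [m1 hm1] := geometric_small XY0 q56.
have /choice[M hM] : forall m, exists M, jet_le 1 k (fun h => alpha_u A m (p + h)) M.
  by move=> m; have [+ _] := alpha_uP m; apply.
have M0 m := jet_le_ge0 ler01 (hM m).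
pose K := \sum_(0 <= i < m1.+1) M i.
have K0 : 0 <= K by apply: sumr_ge0.
have l1 m : 1 <= (3 / 2) ^+ m :> R by rewrite exprn_ege1//; lra.
exists K => // m; have [n] := ubnP m; elim: n m => // n IH m; rewrite ltnS => mn.
have [mm1|m1m] := leqP m m1.
  apply: jet_le_trans (hM m) _; apply: le_trans (_ : K * 1 <= _); last exact: ler_wpM2l.
  rewrite mulr1 /K (bigD1_seq m) ?mem_index_iota ?iota_uniq//=.
  by rewrite lerDl; apply: sumr_ge0.
have m_gt0 : (0 < m)%N := leq_ltn_trans (leq0n _) m1m.
have bm0 : 0 < b%:R ^+ m :> R by rewrite exprn_gt0// ltr0n.
have bge2 : 2 <= b%:R :> R by rewrite ler_nat.
have small := hm1 m (ltnW m1m).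
have q0 : 0 <= (5 / 6) ^+ m :> R by rewrite exprn_ge0//; lra.
have bq : (b%:R ^+ m)^-1 <= (5 / 6) ^+ m :> R.
  have b56 : (b%:R : R)^-1 <= 5 / 6.
    apply: le_trans (_ : 2^-1 <= _); last by lra.
    by rewrite lef_pV2 ?posrE ?ltr0n.
  have bi0 : 0 <= (b%:R : R)^-1 by rewrite invr_ge0.
  by rewrite -exprVn; apply: lerXn2r; rewrite ?nnegrE//; lra.
have xhalf : X / b%:R ^+ m <= 2^-1.
  have h1 := ler_wpM2l X0 bq.
  have h2 : 0 <= 2 * Y * #|A|%:R * (5 / 6) ^+ m by rewrite !mulr_ge0.
  by lra.
have x1 : X / b%:R ^+ m < 1 by lra.
have hinv := jet_le_geom ler01 (hX m) x1.
have hnp := jet_leZ (b%:R ^+ m)^-1 ler01 hY.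
(* By the binomial theorem these add up, with the term [j = 0] included, to
   [#|A| * K * (3 / 2 + (b - 1)) ^ m]. *)
pose S j := 'C(m, j)%:R * (#|A|%:R * (b%:R - 1) ^+ j) * (K * (3 / 2) ^+ (m - j)).
have hS : jet_le 1 k (fun h => \sum_(1 <= j < m.+1 | true && (0 < j <= m)%N)
      'C(m, j)%:R * gamma A j * alpha_u A (m - j) (p + h))
    (\sum_(1 <= j < m.+1 | true && (0 < j <= m)%N) S j).
  apply: jet_le_sum => // j /= /andP[j0 jm].
  apply: (@jet_le_trans _ _ _ _ (cabs ('C(m, j)%:R * gamma A j) * (K * (3 / 2) ^+ (m - j)))).
    apply: jet_leZ => //; apply: IH; apply: leq_trans mn.
    by rewrite ltn_subrL j0.
  rewrite ler_wpM2r ?mulr_ge0 ?exprn_ge0//.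
  by rewrite cabsM cabs_nat ler_wpM2l// gamma_le.
(* Division by [b^(s+m) - N] is multiplication by [b^(-m) * b^(-s) / (1 - xf m s)]; the power
   [b^(-m)] compensates the growth of the sum. *)
have hall := jet_leM ler01 (jet_leM ler01 hinv hnp) hS.
apply: (@jet_le_trans _ _ _ _ _ _ (eq_jet_le _ hall)).
  move=> h hr; rewrite addr0.
  have hx : cabs (xf m (p + h)) < 1.
    by apply: le_lt_trans x1; exact: (jet_le_bound ler01 (hX m)).
  have nz : 1 - xf m (p + h) != 0.
    by rewrite -cabs_gt0; have := cabs_subD 1 (xf m (p + h)); rewrite cabs1; lra.
  have -> : \sum_(1 <= j < m.+1 | true && (0 < j <= m)%N)
      'C(m, j)%:R * gamma A j * alpha_u A (m - j) (p + h) =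
      (npow b (p + h + m%:R) - N) * alpha_u A m (p + h).
    rewrite alpha_u_rec// [RHS]big_nat_cond [LHS]big_nat_cond; apply: eq_bigl => j.
    by rewrite ltnS; case: (0 < j <= m)%N.
  rewrite mulrA -[RHS]mul1r; congr (_ * _).
  have -> : (b%:R ^+ m)^-1 * npow b (- (p + h)) = npow b (- (p + h) - m%:R) :> C.
    by rewrite npow_sub_nat// mulrC.
  by rewrite -mulrA -sub1_alpha_factor// mulVf.
rewrite cabsV cabsX cabs_nat.
have hsum : \sum_(1 <= j < m.+1 | true && (0 < j <= m)%N) S j <=
    #|A|%:R * K * (3 / 2 + (b%:R - 1)) ^+ m.
  have S0 j : 0 <= S j.
    by rewrite /S !mulr_ge0 ?exprn_ge0 ?subr_ge0 ?ler1n//; lra.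
  apply: le_trans (_ : \sum_(0 <= j < m.+1) S j <= _).
    rewrite [leRHS]big_ltn// big_mkcond/=.
    apply: le_trans (_ : \sum_(1 <= j < m.+1) S j <= _); last by rewrite lerDr.
    by apply: ler_sum => j _; case: ifP.
  rewrite le_eqVlt; apply/orP; left; apply/eqP.
  rewrite exprDn big_mkord mulr_sumr; apply: eq_bigr => j _; rewrite /S -mulr_natl.
  by ring.
(* For [m = 1] this is [b + 1 / 2 <= 5 * b / 4], that is, [b >= 2]. *)
have hb54 : (3 / 2 + (b%:R - 1)) ^+ m <= (b%:R ^+ m) * ((3 / 2) ^+ m * (5 / 6) ^+ m) :> R.
  rewrite -!exprMn lerXn2r ?nnegrE//; lra.
have hi : (1 - X / b%:R ^+ m)^-1 <= 2.
  by rewrite -[leRHS]invrK lef_pV2 ?posrE; lra.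
have i0 : 0 <= (1 - X / b%:R ^+ m)^-1 by rewrite invr_ge0; lra.
have AK0 : 0 <= #|A|%:R * K by rewrite mulr_ge0.
apply: le_trans (_ : (2 * ((b%:R ^+ m)^-1 * Y)) *
    (#|A|%:R * K * (b%:R ^+ m * ((3 / 2) ^+ m * (5 / 6) ^+ m))) <= _).
  apply: ler_pM.
  - by do 2![apply: mulr_ge0 => //]; rewrite invr_ge0 ltW.
  - by apply: sumr_ge0 => j _; rewrite /S !mulr_ge0 ?exprn_ge0 ?subr_ge0 ?ler1n//; lra.
  - by rewrite ler_wpM2r// mulr_ge0// invr_ge0 ltW.
  - by apply: le_trans hsum _; exact: ler_wpM2l.
have -> : (2 * ((b%:R ^+ m)^-1 * Y)) * (#|A|%:R * K * (b%:R ^+ m * ((3 / 2) ^+ m * (5 / 6) ^+ m)))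
  = K * (3 / 2) ^+ m * (2 * Y * #|A|%:R * (5 / 6) ^+ m).
  by move: bm0 => /lt0r_neq0 z; move: ((3 / 2) ^+ m : R) ((5 / 6) ^+ m : R) (b%:R ^+ m : R) z =>
     x y z z0; field.
rewrite -[leRHS]mulr1; apply: ler_wpM2l; first by rewrite mulr_ge0// exprn_ge0.
have h2 : 0 <= 2 * X * (5 / 6) ^+ m by rewrite !mulr_ge0.
by move: small; lra.
Qed.

(** As [a1 * b + a2 >= b], the growth [(3 / 2) ^ m] of [alpha_u] meets a decay of [b^(-m)], which
    leaves [(3 / 4) ^ m]; passing from [3 / 4] to [7 / 8] absorbs the Pochhammer quotient. *)
Lemma jet_kempner_term p k : exists2 B : R, 0 <= B &
  forall m, jet_le 1 k (fun h => kempner_term A m (p + h)) (B * (7 / 8) ^+ m).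
Proof.
have [K K0 hK] := jet_alpha_u p k.
have [L L0 hL] := @rising_bound R (cabs p) (cabs_ge0 p).
have /choice[Z hZ] : forall n : nat, exists Z, jet_le 1 k (fun h => npow n (- (p + h) + 0)) Z.
  by move=> n; exact: has_jets_npowN.
have Z0 n := jet_le_ge0 ler01 (hZ n).
pose ZZ := \sum_(a1 in nonzero_digits A) \sum_(a2 in A) Z (a1 * b + a2)%N.
have ZZ0 : 0 <= ZZ by apply: sumr_ge0 => a1 _; apply: sumr_ge0.
have bge2 : 2 <= b%:R :> R by rewrite ler_nat.
exists (K * L * ZZ) => [|m]; first by rewrite !mulr_ge0.
have bm0 : 0 < b%:R ^+ m :> R by rewrite exprn_gt0// ltr0n.
have h1 : jet_le 1 k (fun h => pochhammer (p + h) m) (\prod_(0 <= i < m) (cabs p + i%:R + 1)).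
  apply: jet_le_prod => // i _.
  have := @jet_le_affine R 1 k (p + i%:R) ler01.
  move=> /(@eq_jet_le _ _ _ _ (fun h => p + h + i%:R)) h.
  apply: jet_le_trans (h _) _; first by move=> x _; rewrite addrAC.
  by rewrite lerD2r; apply: le_trans (cabsD _ _) _; rewrite cabs_nat.
have h2 : jet_le 1 k (fun h => \sum_(a1 in nonzero_digits A) \sum_(a2 in A)
    npow (a1 * b + a2)%N (- (p + h) - m%:R)) (ZZ / b%:R ^+ m).
  rewrite mulr_suml; apply: jet_le_sum => // a1; rewrite inE => /andP[_ a1n].
  rewrite mulr_suml; apply: jet_le_sum => // a2 _.
  set n := (a1 * b + a2)%N.
  have bn : (b <= n)%N.
    by apply: leq_trans (leq_addr _ _); rewrite leq_pmull// lt0n.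
  have n0 : (0 < n)%N := leq_trans b0 bn.
  have := jet_leZ (n%:R ^+ m)^-1 ler01 (hZ n).
  move=> /(@eq_jet_le _ _ _ _ (fun h => npow n (- (p + h) - m%:R))) h.
  apply: jet_le_trans (h _) _; first by move=> x _; rewrite addr0 npow_sub_nat// mulrC.
  rewrite cabsV cabsX cabs_nat mulrC ler_wpM2l// lef_pV2 ?posrE ?exprn_gt0 ?ltr0n//.
  by rewrite lerXn2r ?nnegrE// ler_nat.
have h3 := jet_leZ ((-1) ^+ m / m`!%:R) ler01 h1.
have := jet_leM ler01 (jet_leM ler01 h3 (hK m)) h2.
move=> /(@eq_jet_le _ _ _ _ (fun h => kempner_term A m (p + h))) h.
apply: jet_le_trans (h _) _.
  by move=> x _; rewrite /kempner_term; congr (_ * _ * _); rewrite mulrAC mulrA.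
rewrite cabsM cabsX cabsN cabs1 expr1n mul1r cabsV cabs_nat.
have {}hL := hL m.
set PP := \prod_(0 <= i < m) _ in hL *.
have PP0 : 0 <= PP by apply: prodr_ge0 => i _; rewrite !addr_ge0 ?cabs_ge0.
have h4 : (3 / 2) ^+ m / b%:R ^+ m <= (3 / 4) ^+ m :> R.
  rewrite ler_pdivrMr// -exprMn lerXn2r ?nnegrE//; lra.
have -> : (m`!%:R)^-1 * PP * (K * (3 / 2) ^+ m) * (ZZ / b%:R ^+ m) =
  K * ZZ * (PP / m`!%:R) * ((3 / 2) ^+ m / b%:R ^+ m) by ring.
have c0 : 0 <= K * ZZ * (PP / m`!%:R) by rewrite !mulr_ge0.
apply: le_trans (ler_wpM2l c0 h4) _.
by have := ler_wpM2l (mulr_ge0 K0 ZZ0) hL; lra.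
Qed.

Lemma kempner_sum_has_jets :
  (forall m, has_jets (kempner_term A m : C -> C)) /\
  (forall s, cvgn (series (fun m => kempner_term A m s))) /\
  has_jets (fun s => limn (series (fun m => kempner_term A m s))).
Proof.
have hS B : 0 <= B -> forall n, series (fun m => B * (7 / 8) ^+ m) n <= B * (1 - 7 / 8)^-1 :> R.
  move=> B0 n; rewrite seriesE -mulr_sumr ler_wpM2l// geometric_sum_le//; lra.
split=> [m p k|]; last split=> [s|p k].
- by have [B _ hB] := jet_kempner_term p k; exists (B * (7 / 8) ^+ m).
- have [B B0 hB] := jet_kempner_term s 0.
  have := jet_le_cvg_series ler01 hB (hS B B0) (h := 0).
  by rewrite cabs0 addr0; apply; exact: ler01.
- have [B B0 hB] := jet_kempner_term p k.
  exact: jet_le_series ltr01 hB (hS B B0).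
Qed.

End AlphaU.

(** * Sums over admissible integers *)

Section Digits.
Context (b : nat) (A : {set 'I_b}) (hb : (1 < b)%N).
Implicit Types (n l a : nat).

Let b0 : (0 < b)%N := ltnW hb.

Definition digit_in a := [exists d in A, (d : nat) == a].

Lemma digit_in_ord (a : 'I_b) : digit_in a = (a \in A).
Proof.
apply/existsP/idP => [[d /andP[dA /eqP/val_inj <-]]//|aA].
by exists a; rewrite aA eqxx.
Qed.

Lemma admissibleP n : reflect
  ((0 < n)%N /\ forall i, (i <= trunc_log b n)%N -> digit_in ((n %/ b ^ i) %% b)%N)
  (admissible A n).
Proof.
apply: (iffP andP) => -[n0 h]; split=> //.
  by move=> i ile; have /forallP/(_ (Ordinal (ile : (i < _.+1)%N))) := h.
by apply/forallP => i; exact: h (leq_ord i).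
Qed.

Lemma admissible_single n : (0 < n < b)%N -> admissible A n = digit_in n.
Proof.
move=> /andP[n0 nb].
have t0 : trunc_log b n = 0%N.
  by apply: trunc_log_eq; rewrite // expn0 n0 expn1.
apply/admissibleP/idP => [[_ /(_ 0%N)]|h].
  by rewrite t0 expn0 divn1 modn_small//; apply.
by split=> // i; rewrite t0 leqn0 => /eqP ->; rewrite expn0 divn1 modn_small.
Qed.

Lemma admissible_append n a : (0 < n)%N -> (a < b)%N ->
  admissible A (n * b + a) = admissible A n && digit_in a.
Proof.
move=> n0 ab.
have tE : trunc_log b (n * b + a) = (trunc_log b n).+1.
  have /andP[lo hi] := trunc_log_bounds hb n0.
  apply: trunc_log_eq => //; rewrite !expnS; apply/andP; split.
    by apply: leq_trans (leq_addr _ _); rewrite mulnC leq_pmul2r// -expnS.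
  apply: (@leq_trans (n.+1 * b)%N); first by rewrite mulSn addnC ltn_add2r.
  by rewrite mulnC leq_pmul2l// -expnS.
have dE i : ((n * b + a) %/ b ^ i.+1 = n %/ b ^ i)%N.
  by rewrite expnS divnMA divnMDl// (divn_small ab) addn0.
have d0 : ((n * b + a) %/ b ^ 0 %% b = a)%N.
  by rewrite expn0 divn1 modnMDl modn_small.
apply/admissibleP/andP => [[_ h]|[/admissibleP[_ h] ha]].
  split; last by have := h 0%N; rewrite d0; apply.
  apply/admissibleP; split=> // i ile.
  by have := h i.+1; rewrite tE ltnS dE; apply.
split; first by rewrite addn_gt0 muln_gt0 n0 b0.
move=> [|i]; first by rewrite d0.
by rewrite tE ltnS dE; exact: h.
Qed.

Variable V : nmodType.
Implicit Types f g : nat -> V.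

(** The transfer operator of the digit tree: its [l]-th iterate sums [f] over all extensions of [n]
    by [l] digits of [A]. *)
Definition append_digit f n := \sum_(a in A) f (n * b + a)%N.

(** Level [l] consists of the integers with [l.+1] digits. *)
Definition level_sum l f := \sum_(b ^ l <= n < b ^ l.+1 | admissible A n) f n.

Lemma sum_nat_blocks f p q : (p <= q)%N ->
  \sum_(p * b <= i < q * b) f i = \sum_(p <= n < q) \sum_(a < b) f (n * b + a)%N.
Proof.
elim: q => [|q IH]; first by rewrite leqn0 => /eqP ->; rewrite !big_geq.
rewrite leq_eqVlt => /predU1P[->|pq]; first by rewrite !big_geq.
rewrite big_nat_recr//= -IH// (@big_cat_nat _ _ _ (q * b)) ?leq_mul//=.
congr (_ + _); rewrite -{1}[(q * b)%N]add0n big_addn mulSn addnK big_mkord.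
by apply: eq_bigr => i _; rewrite addnC.
Qed.

Lemma level_sum_succ l f : level_sum l.+1 f = level_sum l (append_digit f).
Proof.
rewrite /level_sum big_mkcond [in RHS]big_mkcond/=.
rewrite !(expnSr b l.+1) (expnSr b l) sum_nat_blocks ?leq_pmulr//.
apply: eq_big_nat => n /andP[nl _]; have n0 : (0 < n)%N by apply: leq_trans nl; rewrite expn_gt0 b0.
case: ifP => an; last by rewrite big1// => a _; rewrite admissible_append// an.
rewrite /append_digit [RHS]big_mkcond/=; apply: eq_bigr => a _.
by rewrite admissible_append// an digit_in_ord.
Qed.

Lemma level_sum0 f : level_sum 0 f = \sum_(a in nonzero_digits A) f a.
Proof.
rewrite /level_sum expn0 expn1.
have -> : \sum_(1 <= n < b | admissible A n) f n =
          \sum_(0 <= n < b | (n != 0%N) && admissible A n) f n.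
  rewrite [RHS]big_ltn_cond//=; rewrite [LHS]big_nat_cond [RHS]big_nat_cond.
  by apply: eq_bigl => -[|n].
rewrite big_mkord; apply: eq_bigl => a; rewrite inE andbC.
by case: eqVneq => //= a0; rewrite ?andbF// !andbT admissible_single ?digit_in_ord// lt0n a0/=.
Qed.

Lemma level_sum_iter l f : level_sum l f =
  \sum_(a in nonzero_digits A) iter l append_digit f a.
Proof. by elim: l f => [|l IH] f; [rewrite level_sum0|rewrite level_sum_succ IH -iterSr]. Qed.

(** On level [l.+1] the outermost [append_digit] supplies the second leading digit and the [l] inner
    ones the rest. The single digits form the sum that the theorem subtracts from [K(s)]. *)
Lemma sum_admissible L f : \sum_(0 <= n < b ^ L.+1 | admissible A n) f n =
  \sum_(a in nonzero_digits A) f a +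
  \sum_(a1 in nonzero_digits A) \sum_(a2 in A)
     \sum_(0 <= l < L) iter l append_digit f (a1 * b + a2)%N.
Proof.
have -> : \sum_(0 <= n < b ^ L.+1 | admissible A n) f n = \sum_(0 <= l < L.+1) level_sum l f.
  elim: L.+1 => [|k IH].
    by rewrite [RHS]big_geq// expn0 big_ltn_cond// big_geq.
  rewrite [RHS]big_nat_recr//= -IH /level_sum.
  by apply: big_cat_nat => //; rewrite leq_exp2l.
rewrite big_nat_recl//= level_sum0; congr (_ + _).
under eq_bigr do rewrite level_sum_iter.
rewrite exchange_big/=; apply: eq_bigr => a1 _.
by rewrite [RHS]exchange_big.
Qed.

End Digits.

Arguments append_digit {b} A {V} f n.
Arguments level_sum {b} A {V} l f.

(** * The binomial series of [(1 + t) ^ (- s)] *)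

Section Binomial.
Local Open Scope complex_scope.
Context {R : realType}.
Local Notation C := (Cplx R).
Implicit Types (s : C) (m k : nat) (t : R).

Definition binom_coef s m : C := (-1) ^+ m * (pochhammer s m / m`!%:R).

Lemma cabs_binom_coef s m :
  cabs (binom_coef s m) <= \prod_(0 <= i < m) (cabs s + i%:R + 1) / m`!%:R.
Proof.
rewrite /binom_coef cabsM cabsX cabsN cabs1 expr1n mul1r cabsM cabsV cabs_nat.
by rewrite ler_wpM2r ?invr_ge0//; exact: cabs_pochhammer.
Qed.

(** The derivative [G i] contains [(1 + t) ^ (- s - i)], of modulus at most 1 as [Re s >= 0] and
    [t >= 0]. The Taylor remainder is therefore at most [2 * |(s)_k| / k! * t ^ k], and [t <= 3 / 4]
    lets [rising_bound] send it to 0. *)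
Lemma binomial_series s t : 0 <= complex.Re s -> 0 <= t <= 2^-1 ->
  series (fun m => binom_coef s m * (t ^+ m)%:C) @ \oo -->
    cexp (- s * (ln (1 + t))%:C).
Proof.
move=> s0 tT; pose T : R := 2^-1.
pose G i (x : R) : C := (-1) ^+ i * pochhammer s i * cexp (- (s + i%:R) * (ln (1 + x))%:C).
have hG i x : 0 <= x <= T -> is_cderive x (G i) (G i.+1 x).
  move=> /andP[x0 _]; have x1 : 0 < 1 + x by rewrite ltr_pwDl.
  have dln : is_derive x 1 (fun y => ln (1 + y)) (1 + x)^-1.
    have h1 : is_derive x 1 (fun y : R => 1 + y) 1.
      have -> : (fun y : R => 1 + y) = cst 1 \+ id by [].
      by have := is_deriveD (is_derive_cst (1 : R) x 1) (is_derive_id x 1); rewrite add0r.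
    have h2 : is_derive (1 + x) 1 (@ln R) (1 + x)^-1 := is_derive1_ln x1.
    by have := @is_derive1_comp R (@ln R) (fun y => 1 + y) x _ _ h2 h1; rewrite mulr1.
  have := @is_cderive_cexp R ((-1) ^+ i * pochhammer s i) (- (s + i%:R)) _ _ x dln.
  have -> // : (-1) ^+ i * pochhammer s i * (- (s + i%:R) * ((1 + x)^-1)%:C) *
     cexp (- (s + i%:R) * (ln (1 + x))%:C) = G i.+1 x.
  have e : ((1 + x)^-1)%:C = cexp (- (ln (1 + x))%:C) :> C.
    by rewrite cexpN cexpR lnK ?posrE// fmorphV.
  rewrite /G e /pochhammer big_nat_recr//= exprS.
  have -> : - (s + i.+1%:R) * (ln (1 + x))%:C =
     - (ln (1 + x))%:C + - (s + i%:R) * (ln (1 + x))%:C by rewrite -natr1; ring.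
  rewrite cexpD; move: (cexp _) (cexp _) (\prod_(_ <= _ < _) _) => u v w.
  by ring.
have hB k x : 0 <= x <= T -> cabs (G k x) <= cabs (pochhammer s k).
  move=> /andP[x0 _]; rewrite /G (cabsM (_ * _)) (cabsM (_ ^+ _)) cabsX cabsN cabs1 expr1n mul1r.
  rewrite -[leRHS]mulr1 ler_wpM2l ?cabs_ge0// cabs_cexp ReM /= mulr0 subr0.
  rewrite -[leRHS](@expR0 R) ler_expR; apply: mulr_le0_ge0; last by rewrite ln_ge0// lerDl.
  rewrite ReN oppr_le0 ReD addr_ge0//.
  have -> : (k%:R : C) = (k%:R : R)%:C by rewrite rmorph_nat.
  by [].
have key k : cabs (cexp (- s * (ln (1 + t))%:C) -
    series (fun m => binom_coef s m * (t ^+ m)%:C) k) <=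
    2 * (\prod_(0 <= i < k) (cabs s + i%:R + 1) / k`!%:R * (3 / 4) ^+ k).
  have := taylor_boundC hG (hB k) tT.
  rewrite /G expr0 /pochhammer big_geq// !mul1r addr0.
  have -> : \sum_(0 <= i < k) (-1) ^+ i * \prod_(0 <= i0 < i) (s + i0%:R) *
      cexp (- (s + i%:R) * (ln (1 + 0))%:C) * (t ^+ i / i`!%:R)%:C =
      series (fun m => binom_coef s m * (t ^+ m)%:C) k.
    rewrite seriesE; apply: eq_bigr => i _.
    rewrite addr0 ln1 mulr0 cexp0 mulr1 /binom_coef /pochhammer rmorphM fmorphV rmorph_nat.
    by rewrite -!mulrA; congr (_ * (_ * _)); rewrite mulrC.
  move=> /le_trans; apply; rewrite -mulrA; apply: ler_wpM2l => //.
  have [t0 t2] := andP tT.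
  rewrite [leRHS]mulrAC -[leRHS]mulrA; apply: ler_pM.
  - exact: cabs_ge0.
  - by rewrite divr_ge0 ?exprn_ge0.
  - exact: cabs_pochhammer.
  - by rewrite ler_wpM2r ?invr_ge0// lerXn2r ?nnegrE//; move: t2; lra.
have [K K0 hK] := rising_bound (cabs_ge0 s).
have h0 : 2 * (K * (7 / 8) ^+ k) @[k --> \oo] --> (0 : R).
  have h : 2 * (K * (7 / 8) ^+ k) @[k --> \oo] --> (2 * (K * 0) : R).
    by do 2![apply: cvgMl_tmp]; apply: cvg_expr; rewrite ger0_norm//; lra.
  by rewrite !mulr0 in h.
apply: cabs_lt_cvg => e e0.
have [n _ hn] := cvgr_lt _ h0 _ e0; exists n => // k nk; apply: le_lt_trans (hn k nk).
by rewrite cabsB; apply: le_trans (key k) _; rewrite ler_wpM2l.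
Qed.

End Binomial.

(** * The identity in the half plane of absolute convergence *)

Section HalfPlane.
Local Open Scope complex_scope.
Context {R : realType} (b : nat) (A : {set 'I_b}) (hb : (1 < b)%N).
Context (hA : exists2 a : 'I_b, a \in A & (a : nat) != 0%N).
Local Notation C := (Cplx R).
Variable s : C.
Hypothesis hs : ln (#|A|%:R : R) / ln (b%:R : R) < complex.Re s.

Let N : C := #|A|%:R.
Let b0 : (0 < b)%N := ltnW hb.
Let bR0 : 0 < b%:R :> R. Proof. by rewrite ltr0n. Qed.
Let lnb : 0 < ln (b%:R : R). Proof. by rewrite ln_gt0// ltr1n. Qed.
Let A0 : (0 < #|A|)%N.
Proof. by have [a aA _] := hA; apply/card_gt0P; exists a. Qed.

(** The ratio of successive levels: [#|A|] choices of a new digit, each at the cost of a factor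
    [b ^ (- Re s)]. *)
Let q : R := #|A|%:R * cabs (npow b (- s)).

Lemma Re_s_gt0 : 0 < complex.Re s.
Proof. by apply: le_lt_trans hs; rewrite divr_ge0 ?ln_ge0 ?ler1n// ltW. Qed.

Lemma q_bounds : 0 <= q < 1.
Proof.
rewrite mulr_ge0 ?cabs_ge0//= /q cabs_npow ReN mulNr expRN.
rewrite ltr_pdivrMr ?expR_gt0// mul1r -[ltLHS]lnK ?posrE ?ltr0n//.
by rewrite ltr_expR -ltr_pdivrMr.
Qed.

(** Here [|b^(s+j)| >= |b^s| > N]. Hence no [u m] has a pole in the half plane, and no factor of
    [alpha] vanishes there. *)
Lemma npow_gt_card j : npow b (s + j%:R) != N.
Proof.
apply: contraTneq q_bounds => h; rewrite negb_and -leNgt; apply/orP; right.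
have : cabs (npow b (s + j%:R)) = #|A|%:R by rewrite h cabs_nat.
rewrite npowD npow_nat// cabsM cabsX cabs_nat /q npowN cabsV => <-.
rewrite mulrAC divff ?mul1r ?cabs_eq0 ?npow_neq0//.
by rewrite exprn_ege1// ler1n.
Qed.

(* The fractions [a_1 / b + ... + a_l / b ^ l] with all digits in [A]. *)
Fixpoint tails l : seq R :=
  if l is l'.+1 then [seq ((nat_of_ord a)%:R + x) / b%:R | a <- enum A, x <- tails l']
  else [:: 0].

Lemma sum_tails_succ (V : nmodType) (F : R -> V) l :
  \sum_(x <- tails l.+1) F x =
  \sum_(a in A) \sum_(x <- tails l) F (((a : nat)%:R + x) / b%:R).
Proof.
rewrite /= big_allpairs_dep/= big_enum/=.
by [].
Qed.

Lemma size_tails l : size (tails l) = (#|A| ^ l)%N.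
Proof. by elim: l => //= l IH; rewrite size_allpairs IH -cardE expnS. Qed.

Lemma tails_itv l x : x \in tails l -> 0 <= x <= 1.
Proof.
elim: l x => [|l IH] x /=; first by rewrite inE => /eqP ->; rewrite lexx ler01.
move=> /allpairsP[[a y] /= [_ /IH/andP[y0 y1] ->]].
rewrite divr_ge0 ?addr_ge0//= ler_pdivrMr// mul1r.
apply: le_trans (_ : (a : nat)%:R + 1 <= _); first by rewrite lerD2l.
by rewrite natr1 ler_nat ltn_ord.
Qed.

(** The contribution of the digit strings of length [l] to the series that represents [u m] in the
    half plane. *)
Definition moment l m : C := npow b (- s) ^+ l * \sum_(x <- tails l) (x ^+ m)%:C.

Lemma moment0 m : moment 0 m = 0 ^+ m.
Proof. by rewrite /moment expr0 mul1r /= big_seq1 rmorphXn. Qed.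

(** Expanding [((a + x) / b) ^ m], with [a] the leading digit, produces the power sums [gamma];
    summation over [l] turns this into the recursion of [u]. *)
Lemma moment_succ l m : moment l.+1 m =
  npow b (- s) / b%:R ^+ m *
  \sum_(0 <= j < m.+1) 'C(m, j)%:R * gamma A j * moment l (m - j).
Proof.
rewrite /moment sum_tails_succ exprS -(mulrA (npow b (- s))).
rewrite -(mulrA (npow b (- s)) (b%:R ^+ m)^-1); congr (_ * _).
have -> : \sum_(a in A) \sum_(x <- tails l) ((((a : nat)%:R + x) / b%:R) ^+ m)%:C =
  (b%:R ^+ m)^-1 * \sum_(0 <= j < m.+1) 'C(m, j)%:R * gamma A j *
     \sum_(x <- tails l) (x ^+ (m - j))%:C :> C.
  rewrite mulr_sumr.
  under [RHS]eq_bigr => j _ do rewrite /gamma mulr_sumr mulr_suml mulr_sumr.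
  rewrite [RHS]exchange_big/=; apply: eq_bigr => a _.
  under [RHS]eq_bigr => j _ do rewrite mulr_sumr mulr_sumr.
  rewrite [RHS]exchange_big/=; apply: eq_bigr => x _.
  rewrite exprMn addrC exprDn !rmorphM/= mulrC exprVn fmorphV rmorphXn rmorph_nat.
  rewrite rmorph_sum/= mulr_sumr big_mkord; apply: eq_bigr => j _.
  congr (_ * _); rewrite -[_ *+ 'C(m, j)]mulr_natl !rmorphM !rmorphXn !rmorph_nat.
  by rewrite [x%:C ^+ _ * _]mulrC mulrA.
rewrite mulrCA; congr (_ * _); rewrite mulr_sumr; apply: eq_bigr => j _.
by rewrite mulrCA.
Qed.

Lemma cabs_moment l m : cabs (moment l m) <= q ^+ l.
Proof.
rewrite /moment cabsM cabsX /q exprMn mulrC ler_wpM2r ?exprn_ge0 ?cabs_ge0//.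
apply: le_trans (cabs_sum _ _ _) _.
rewrite -natrX -size_tails -sum1_size natr_sum big_seq [leRHS]big_seq.
apply: ler_sum => x /tails_itv/andP[x0 x1].
by rewrite cabsR ger0_norm ?exprn_ge0// exprn_ile1.
Qed.

Definition moment_sum L m : C := \sum_(0 <= l < L) moment l m.

Lemma cabs_moment_sum L m : cabs (moment_sum L m) <= (1 - q)^-1.
Proof.
apply: le_trans (cabs_sum _ _ _) _; apply: le_trans (geometric_sum_le L q_bounds).
by apply: ler_sum => l _; exact: cabs_moment.
Qed.

(** The limits [S] exist by comparison with a geometric series and satisfy the recursion of [u],
    whose divisors do not vanish here; strong induction identifies the two. *)
Lemma moment_sum_cvg m : moment_sum L m @[L --> \oo] --> u A m s.
Proof.
have cv k : cvgn (series (fun l => moment l k)).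
  apply: (@abs_series_cvg _ _ (1 - q)^-1) => n.
  apply: le_trans (geometric_sum_le n q_bounds).
  by apply: ler_sum => l _; exact: cabs_moment.
pose S k := limn (series (fun l => moment l k)).
have cS k : moment_sum L k @[L --> \oo] --> S k by exact: cv.
have SE k : (npow b (s + k%:R) - N) * S k =
    npow b (s + k%:R) * 0 ^+ k + \sum_(1 <= j < k.+1) 'C(k, j)%:R * gamma A j * S (k - j)%N.
  have h1 : moment_sum L.+1 k @[L --> \oo] --> S k.
    have := cS k; rewrite -(@cvg_shiftS _ (fun L => moment_sum L k)); apply.
  have h2 : moment_sum L.+1 k @[L --> \oo] --> 0 ^+ k + npow b (- s) / b%:R ^+ k *
      \sum_(0 <= j < k.+1) 'C(k, j)%:R * gamma A j * S (k - j)%N.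
    have -> : (fun L => moment_sum L.+1 k) = (fun L => 0 ^+ k + npow b (- s) / b%:R ^+ k *
      \sum_(0 <= j < k.+1) 'C(k, j)%:R * gamma A j * moment_sum L (k - j)).
      apply/funext => L; rewrite /moment_sum big_nat_recl//= moment0; congr (_ + _).
      under eq_bigr do rewrite moment_succ.
      rewrite -mulr_sumr exchange_big/=; congr (_ * _); apply: eq_bigr => j _.
      by rewrite -mulr_sumr.
    apply: cvgD; first exact: cvg_cst.
    apply: cvgn_mull; apply: cvgn_sum => j _; apply: cvgn_mull; exact: cS.
  have e := etrans (esym (cvgn_limE h1)) (cvgn_limE h2).
  (* The term [j = 0] is [N * S k]; moved to the left, it turns [npow b (s + k%:R)] into the divisor
     of the recursion. *)
  have g0 : gamma A 0 = N :> C.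
    by rewrite /gamma; under eq_bigr do rewrite expr0; rewrite sumr_const.
  have nz : npow b s != 0 by exact: npow_neq0.
  have bk : (b%:R : C) ^+ k != 0 by rewrite expf_neq0// pnatr_eq0 -lt0n.
  rewrite npowD npow_nat// mulrBl {1}e mulrDr.
  rewrite big_ltn// bin0 mul1r subn0 g0 npowN.
  move: (\sum_(1 <= j < k.+1) _) => Z.
  by field; rewrite nz bk.
suff -> : u A m s = S m by exact: cS.
have [n] := ubnP m; elim: n m => // n IH m; rewrite ltnS => mn.
have nz : npow b (s + m%:R) - N != 0 by rewrite subr_eq0 npow_gt_card.
apply: (mulfI nz); rewrite SE; case: m nz mn => [|m] nz mn.
  by rewrite u0E expr0 mulr1 big_geq// !addr0 in nz *; rewrite mulrC divfK.
rewrite expr0n mulr0 add0r u_rec ?npow_gt_card//; apply: eq_big_nat => j /andP[j0 _].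
by rewrite IH//; apply: leq_trans mn; rewrite ltn_subrL j0.
Qed.

(** The outermost digit stands right after [n], so it becomes the leading digit of [x], in agreement
    with the order in which [tails] adds digits. *)
Lemma iter_append_digit l n : (0 < n)%N ->
  iter l (append_digit A) (fun n => npow n (- s)) n =
  \sum_(x <- tails l) cexp (- s * (ln (b%:R ^+ l * (n%:R + x)))%:C).
Proof.
elim: l n => [|l IH] n n0; first by rewrite /= big_seq1 expr0 mul1r addr0.
rewrite iterS sum_tails_succ; apply: eq_bigr => a _.
rewrite IH ?addn_gt0 ?muln_gt0 ?n0 ?b0//; apply: eq_bigr => x _.
congr (cexp (_ * (ln _)%:C)); rewrite natrD natrM exprSr.
by field; rewrite pnatr_eq0 -lt0n.
Qed.

Lemma iter_append_digit_series l n : (1 < n)%N ->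
  series (fun m => binom_coef s m * (n%:R ^+ m)^-1 * moment l m) @ \oo -->
    npow n s * iter l (append_digit A) (fun n => npow n (- s)) n.
Proof.
move=> n1; have n0 : (0 < n)%N := ltnW n1.
have nR : 0 < n%:R :> R by rewrite ltr0n.
rewrite iter_append_digit//.
have -> : npow n s * \sum_(x <- tails l) cexp (- s * (ln (b%:R ^+ l * (n%:R + x)))%:C) =
  npow b (- s) ^+ l * \sum_(x <- tails l) cexp (- s * (ln (1 + x / n%:R))%:C).
  rewrite !mulr_sumr big_seq [RHS]big_seq; apply: eq_bigr => x /tails_itv/andP[x0 _].
  have x1 : 0 < 1 + x / n%:R by rewrite ltr_pwDl// divr_ge0// ltW.
  have -> : b%:R ^+ l * (n%:R + x) = b%:R ^+ l * (n%:R * (1 + x / n%:R)) :> R.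
    by field; rewrite gt_eqF.
  rewrite lnM ?posrE ?exprn_gt0 ?mulr_gt0// lnM ?posrE// lnXn// -[ln b%:R *+ l]mulr_natl.
  rewrite /npow -cexpMn -!cexpD; congr cexp.
  by rewrite !rmorphD !rmorphM rmorph_nat; ring.
have -> : series (fun m => binom_coef s m * (n%:R ^+ m)^-1 * moment l m) =
  (fun k => npow b (- s) ^+ l * \sum_(x <- tails l)
     series (fun m => binom_coef s m * ((x / n%:R) ^+ m)%:C) k).
  apply/funext => k; rewrite [LHS]seriesE.
  under [in RHS]eq_bigr do rewrite seriesE.
  rewrite exchange_big/= mulr_sumr; apply: eq_bigr => m _.
  rewrite /moment mulrCA; congr (_ * _); rewrite !mulr_sumr; apply: eq_bigr => x _.
  rewrite -mulrA; congr (_ * _); rewrite exprMn exprVn rmorphM fmorphV.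
  by rewrite !rmorphXn rmorph_nat mulrC.
apply: cvgn_mull; rewrite big_seq.
have -> : (fun k => \sum_(x <- tails l) series (fun m => binom_coef s m * ((x / n%:R) ^+ m)%:C) k) =
  (fun k => \sum_(x <- tails l | x \in tails l)
     series (fun m => binom_coef s m * ((x / n%:R) ^+ m)%:C) k).
  by apply/funext => k; rewrite big_seq.
apply: cvgn_sum => x /tails_itv/andP[x0 x1].
apply: binomial_series; first exact: ltW Re_s_gt0.
apply/andP; split; first by rewrite divr_ge0// ltW.
rewrite ler_pdivrMr//; apply: le_trans x1 _.
have : 2 <= n%:R :> R by rewrite ler_nat.
by lra.
Qed.

(** Multiplied by [npow n (- s)], this is the sum over [n] and all integers formed by appending
    digits of [A] to it. *)
Definition block_sum n : C := limn (series (fun m => binom_coef s m * (n%:R ^+ m)^-1 * u A m s)).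

(** The majorant is uniform in [v]: it covers the truncated moment sums for every [L] as well as
    their limit [u], through their common bound [(1 - q)^-1]. *)
Lemma block_majorant n : (1 < n)%N -> exists2 K, 0 <= K &
  forall (v : nat -> C) m, (forall j, cabs (v j) <= (1 - q)^-1) ->
  cabs (binom_coef s m * (n%:R ^+ m)^-1 * v m) <= K * (7 / 8) ^+ m.
Proof.
move=> n1; have [K K0 hK] := rising_bound (cabs_ge0 s).
have B0 : 0 <= (1 - q)^-1 by have /andP[_ ?] := q_bounds; rewrite invr_ge0 subr_ge0 ltW.
have half m : (n%:R ^+ m)^-1 <= (3 / 4) ^+ m :> R.
  have n34 : (n%:R : R)^-1 <= 3 / 4.
    apply: le_trans (_ : 2^-1 <= _); last by lra.
    by rewrite lef_pV2 ?posrE ?ltr0n ?ler_nat// ltnW.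
  have ni0 : 0 <= (n%:R : R)^-1 by rewrite invr_ge0.
  by rewrite -exprVn; apply: lerXn2r; rewrite ?nnegrE//; lra.
exists (K * (1 - q)^-1) => [|v m hv]; first by rewrite mulr_ge0.
rewrite (cabsM (_ * _)) (cabsM (binom_coef s m)) cabsV cabsX cabs_nat [leRHS]mulrAC; apply: ler_pM.
- by rewrite mulr_ge0 ?invr_ge0 ?exprn_ge0 ?cabs_ge0.
- exact: cabs_ge0.
- apply: le_trans (hK m); apply: ler_pM; rewrite ?cabs_ge0 ?invr_ge0 ?exprn_ge0//.
  exact: cabs_binom_coef.
- exact: hv.
Qed.

Lemma geometric78_le (K : R) n : 0 <= K ->
  series (fun m => K * (7 / 8) ^+ m) n <= K * (1 - 7 / 8)^-1.
Proof.
move=> K0; rewrite seriesE -mulr_sumr ler_wpM2l//.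
by apply: geometric_sum_le; apply/andP; split; lra.
Qed.

Lemma cabs_u m : cabs (u A m s) <= (1 - q)^-1.
Proof.
have h : cabs (moment_sum L m) @[L --> \oo] --> cabs (u A m s).
  by apply: cvg_cabs_lim; exact: moment_sum_cvg.
by apply: (cvgr_to_le h); apply: nearW => L; exact: cabs_moment_sum.
Qed.

Lemma block_sum_cvg n : (1 < n)%N ->
  series (fun m => binom_coef s m * (n%:R ^+ m)^-1 * u A m s) @ \oo --> block_sum n.
Proof.
move=> n1; have [K K0 hK] := block_majorant n1.
apply: (@abs_series_cvg _ _ (K * (1 - 7 / 8)^-1)).
apply: (@series_dominated _ _ (fun m => K * (7 / 8) ^+ m)) => m.
  by apply: (hK (fun m => u A m s)) => j; exact: cabs_u.
exact: geometric78_le.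
Qed.

(** For fixed [L] the sum over the levels is finite and passes inside the series in [m]; [tannery]
    then takes the limit in [L] term by term. *)
Lemma iter_append_digit_cvg n : (1 < n)%N ->
  \sum_(0 <= l < L) iter l (append_digit A) (fun n => npow n (- s)) n @[L --> \oo] -->
    npow n (- s) * block_sum n.
Proof.
move=> n1.
have -> : (fun L => \sum_(0 <= l < L) iter l (append_digit A) (fun n => npow n (- s)) n) =
  (fun L => npow n (- s) *
    limn (series (fun m => binom_coef s m * (n%:R ^+ m)^-1 * moment_sum L m))).
  apply/funext => L.
  have h : series (fun m => binom_coef s m * (n%:R ^+ m)^-1 * moment_sum L m) @ \oo -->
     npow n s * \sum_(0 <= l < L) iter l (append_digit A) (fun n => npow n (- s)) n.
    have -> : series (fun m => binom_coef s m * (n%:R ^+ m)^-1 * moment_sum L m) =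
      (fun k => \sum_(0 <= l < L) series (fun m => binom_coef s m * (n%:R ^+ m)^-1 * moment l m) k).
      apply/funext => k; rewrite seriesE.
      under [in RHS]eq_bigr do rewrite seriesE.
      by rewrite exchange_big/=; apply: eq_bigr => m _; rewrite mulr_sumr.
    rewrite mulr_sumr; apply: cvgn_sum => l _; exact: iter_append_digit_series.
  by rewrite (cvgn_limE h) npowN mulKf// npow_neq0.
apply: cvgn_mull.
have [K K0 hK] := block_majorant n1.
apply: (@tannery _ _ _ (fun m => K * (7 / 8) ^+ m) (K * (1 - 7 / 8)^-1)).
- by move=> L m; apply: (hK (moment_sum L)) => j; exact: cabs_moment_sum.
- by move=> k; exact: geometric78_le.
- by move=> m; apply: cvgn_mull; exact: moment_sum_cvg.
Qed.

(** Level [l] has [#|nonzero_digits A| * #|A| ^ l] admissible members, each at least [b ^ l], and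
    [|n^(-s)|] decreases in [n] because [Re s > 0]. *)
Lemma kempner_abs_bound k :
  \sum_(0 <= n < k) cabs (if admissible A n then npow n (- s) else 0 : C) <=
  #|nonzero_digits A|%:R * (1 - q)^-1.
Proof.
pose h n : R := if admissible A n then cabs (npow n (- s)) else 0.
have h0 n : 0 <= h n by rewrite /h; case: ifP => // _; exact: cabs_ge0.
have -> : \sum_(0 <= n < k) cabs (if admissible A n then npow n (- s) else 0 : C) =
   \sum_(0 <= n < k) h n by apply: eq_bigr => n _; rewrite /h; case: ifP => //; rewrite cabs0.
apply: le_trans (_ : \sum_(0 <= n < b ^ k.+1) h n <= _).
  rewrite [leRHS](@big_cat_nat _ _ _ k)//=; last first.
    by apply: ltnW; apply: leq_trans (ltn_expl _ hb); rewrite ltnS leqnSn.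
  by rewrite lerDl; apply: sumr_ge0.
have count l : level_sum A l (fun=> 1 : R) = (#|nonzero_digits A| * #|A| ^ l)%:R.
  rewrite level_sum_iter//.
  have e : iter l (append_digit A) (fun=> 1 : R) = (fun=> (#|A| ^ l)%:R).
    elim: l => [|l IH]; first by apply/funext.
    rewrite iterS IH; apply/funext => n.
    by rewrite /append_digit sumr_const -mulrnA -expnSr.
  by rewrite e sumr_const -mulrnA mulnC.
have lev l : \sum_(b ^ l <= n < b ^ l.+1) h n <= #|nonzero_digits A|%:R * q ^+ l.
  apply: le_trans (_ : cabs (npow b (- s)) ^+ l * level_sum A l (fun=> 1 : R) <= _).
    rewrite /level_sum mulr_sumr [leRHS]big_mkcond/= big_nat [leRHS]big_nat.
    apply: ler_sum => n /andP[nl _]; rewrite /h; case: ifP => // _.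
    rewrite mulr1 !cabs_npow -expRM_natl ler_expR ReN !mulNr mulrN lerN2.
    rewrite mulrCA; apply: ler_wpM2l; first exact: ltW Re_s_gt0.
    rewrite mulr_natl -lnXn// ler_ln ?posrE ?exprn_gt0 ?ltr0n//.
      by rewrite -natrX ler_nat.
    by apply: leq_trans nl; rewrite expn_gt0 b0.
  rewrite count natrM natrX /q exprMn le_eqVlt; apply/orP; left; apply/eqP; ring.
have -> : \sum_(0 <= n < b ^ k.+1) h n =
    h 0%N + \sum_(0 <= l < k.+1) \sum_(b ^ l <= n < b ^ l.+1) h n.
  rewrite big_ltn ?expn_gt0 ?b0//; congr (_ + _).
  elim: k.+1 => [|j IH]; first by rewrite expn0 !big_geq.
  by rewrite [RHS]big_nat_recr//= -IH -big_cat_nat ?expn_gt0 ?b0 ?leq_exp2l.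
have -> : h 0%N = 0 by [].
rewrite add0r; apply: le_trans (ler_sum _ (fun l _ => lev l)) _.
by rewrite -mulr_sumr ler_wpM2l// geometric_sum_le// q_bounds.
Qed.

Lemma kempnerE : kempner A s = \sum_(a in nonzero_digits A) npow a (- s) +
  \sum_(a1 in nonzero_digits A) \sum_(a2 in A)
    npow (a1 * b + a2)%N (- s) * block_sum (a1 * b + a2)%N.
Proof.
pose p k : C := \sum_(0 <= n < k | admissible A n) npow n (- s).
have cp : p k @[k --> \oo] --> kempner A s.
  have := abs_series_cvg kempner_abs_bound.
  have -> // : series (fun n => if admissible A n then npow n (- s) else 0 : C) = p.
  by apply/funext => k; rewrite seriesE /p [RHS]big_mkcond.
(* As all partial sums converge, the value can be computed along the cut-offs [b ^ L.+1], where only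
   complete levels occur. *)
have cpb : p (b ^ L.+1)%N @[L --> \oo] --> kempner A s.
  apply: cabs_lt_cvg => e e0; have [n _ hn] := cvg_cabs_lt cp e0.
  exists n => // L /= nL; apply: hn => /=; apply: leq_trans nL _.
  by apply: ltnW; apply: leq_trans (ltn_expl _ hb); rewrite ltnS leqnSn.
rewrite -(cvgn_limE cpb); apply: cvgn_limE.
under eq_fun do rewrite /p (sum_admissible A hb).
apply: cvgD; first exact: cvg_cst.
apply: cvgn_sum => a1; rewrite inE => /andP[_ a1n]; apply: cvgn_sum => a2 _.
apply: iter_append_digit_cvg; apply: leq_trans hb _.
by apply: leq_trans (leq_addr _ _); rewrite leq_pmull// lt0n.
Qed.

End HalfPlane.

(** * Quotients of entire functions with simple zeros in the denominator *)

Section Quotient.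
Local Open Scope complex_scope.
Context {R : realType}.
Local Notation C := (Cplx R).
Implicit Types (f g : C -> C) (p w : C) (k : nat).

Lemma eq_derivable_cabs f g p (d : R) : 0 < d ->
  (forall z, cabs (z - p) < d -> f z = g z) -> derivable g p 1 -> derivable f p 1.
Proof.
move=> d0 fg; apply: near_eq_derivable.
by apply/nbhs_cabs; exists d => // z zp; rewrite fg.
Qed.

Lemma derivable_cvg f p : derivable f p 1 -> f w @[w --> p] --> f p.
Proof.
move=> /cvg_ex[d /cvg_dnbhs_cabs hd]; apply/cvg_nbhs_cabs => e e0.
have [r r0 hr] := hd 1 ltr01.
have K0 : 0 < cabs d + 1 by rewrite ltr_wpDl// cabs_ge0.
exists (Num.min r (e / (cabs d + 1))); first by rewrite lt_min r0 divr_gt0.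
move=> z; rewrite lt_min ltr_pdivlMr// => /andP[zr ze].
have [->|zp] := eqVneq z p; first by rewrite subrr cabs0.
have zp0 : z - p != 0 by rewrite subr_eq0.
have := hr (z - p); rewrite subr0 => /(_ zr zp0).
have sE (a b : C) : a *: b = a * b by [].
rewrite /= !sE mulr1 subrK; set Q := _ * _ => hQ.
have -> : f z - f p = (z - p) * Q by rewrite /Q mulVKf.
rewrite cabsM; apply: le_lt_trans ze; apply: ler_wpM2l; first exact: cabs_ge0.
by have := cabs_subD Q d; lra.
Qed.

Lemma holoD f g p : derivable f p 1 -> derivable g p 1 ->
  derivable (fun z => f z + g z) p 1.
Proof. exact: derivableD. Qed.

Lemma holoM f g p : derivable f p 1 -> derivable g p 1 ->
  derivable (fun z => f z * g z) p 1.
Proof. exact: derivableM. Qed.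

Lemma holoV f p : f p != 0 -> derivable f p 1 -> derivable (fun z => (f z)^-1) p 1.
Proof. exact: derivableV. Qed.

Lemma holo_sub_cst p w : derivable (fun z : C => z - p) w 1.
Proof. by apply: derivableB; [exact: derivable_id|exact: derivable_cst]. Qed.

(** After normalization [1 - g / c] vanishes at 0, so its norm on the disc of radius [r] is at most
    [r * K]; with [r = 1 / (K + 2)] this is below 1 and [jet_le_geom] applies. *)
Lemma jet_le_inv k g M : jet_le 1 k.+1 g M -> g 0 != 0 ->
  exists2 r : R, 0 < r <= 1 & (exists N, jet_le r k.+1 (fun h => (g h)^-1) N) /\
    forall h, cabs h <= r -> g h != 0.
Proof.
move=> [c [g1 [N [hg _ eg]]]] g0.
have gc : g 0 = c by rewrite eg ?cabs0// mul0r addr0.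
rewrite gc in g0; have N0 := jet_le_ge0 ler01 hg.
have c0 : 0 < cabs c by rewrite cabs_gt0.
pose K := cabs (- c^-1) * N; have K0 : 0 <= K by rewrite mulr_ge0 ?cabs_ge0.
pose r := (K + 2)^-1.
have K2 : 0 < K + 2 by lra.
have r0 : 0 < r by rewrite invr_gt0.
have r1 : r <= 1 by rewrite /r invf_le1//; lra.
have hx : jet_le r k.+1 (fun h => 1 - c^-1 * g h) (r * K).
  exists 0, (fun h => - c^-1 * g1 h), K; split.
  - by apply: jet_leZ (ltW r0) _; apply: jet_le_shrink hg => //; exact: ltW.
  - by rewrite cabs0 add0r.
  - by move=> h hr; rewrite eg ?(le_trans hr)//; field.
have rK : r * K < 1 by rewrite mulrC ltr_pdivrMr//; lra.
exists r; first by rewrite r0.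
have nz h : cabs h <= r -> g h != 0.
  move=> /(jet_le_bound (ltW r0) hx) hb; apply: contraTneq hb => ->.
  by rewrite mulr0 subr0 cabs1 -ltNge.
split=> //; exists (cabs c^-1 * (1 - r * K)^-1).
have := jet_leZ c^-1 (ltW r0) (jet_le_geom (ltW r0) hx rK).
apply: eq_jet_le => h hr; have := nz h hr.
by rewrite opprB addrC subrK => gh; rewrite invfM invrK mulKf.
Qed.

(** The numerator [h] of the pole would equal [(w - p) ^ (k - j) * g w] near [p] and tend to 0,
    against [h p != 0]. The case [j = 0] excludes poles where [a] does not vanish, and [j = 1]
    excludes orders above 1. *)
Lemma not_pole f g p (l : C) j k : (j < k)%N -> pole_of_order f p k ->
  g w @[w --> p^'] --> l -> (\forall w \near p^', f w * (w - p) ^+ j = g w) -> False.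
Proof.
move=> jk [_ [h [hh h0 /dnbhs_cabs[d d0 fE]]]] gl /dnbhs_cabs[d' d'0 gE].
have hc := derivable_cvg (nbhs_singleton hh).
move/eqP: h0; apply.
apply: dnbhs_cvg_unique (cvg_nbhs_dnbhs hc) _.
apply/cvg_dnbhs_cabs => e e0.
have /cvg_dnbhs_cabs/(_ 1 ltr01)[r r0 gb] := gl.
have K0 : 0 < cabs l + 1 by rewrite ltr_wpDl// cabs_ge0.
exists (Num.min (Num.min d d') (Num.min (Num.min r 1) (e / (cabs l + 1)))).
  by rewrite !lt_min d0 d'0 r0 ltr01 divr_gt0.
move=> z; rewrite !lt_min ltr_pdivlMr// => /andP[/andP[zd zd'] /andP[/andP[zr z1] ze]] zp.
have zp0 : z - p != 0 by rewrite subr_eq0.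
have -> : h z - 0 = (z - p) ^+ (k - j) * g z.
  have e1 : (z - p) ^+ k = (z - p) ^+ (k - j) * (z - p) ^+ j by rewrite -exprD subnK// ltnW.
  have nx : (z - p) ^+ (k - j) != 0 by rewrite expf_neq0.
  have ny : (z - p) ^+ j != 0 by rewrite expf_neq0.
  rewrite subr0 -gE// fE// e1; move: (_ ^+ (k - j)) (_ ^+ j) (h z) nx ny => x y t nx ny.
  by field; rewrite nx ny.
rewrite cabsM cabsX; apply: le_lt_trans ze; apply: ler_pM; rewrite ?exprn_ge0 ?cabs_ge0//.
  rewrite -(subnSK jk) exprS; apply: ler_piMr; rewrite ?cabs_ge0//.
  by apply: exprn_ile1; rewrite ?cabs_ge0// ltW.
by have := gb z zr zp; have := cabs_subD (g z) l; lra.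
Qed.

Variables F a S : C -> C.
Hypotheses (hF : has_jets F) (ha : has_jets a) (hS : has_jets S).
(** Simplicity of the zeros in terms of jets: [g 0] is the derivative of [a] at its zero [p]. *)
Hypothesis a_simple : forall p k g c M, a p = 0 -> jet_le 1 k.+1 g M ->
  (forall h, cabs h <= 1 -> a (p + h) = c + h * g h) -> c = 0 /\ g 0 != 0.

(* At a removable zero of [a] the value is the limit of the quotient; at a pole
   it is a junk value. *)
Definition quotient_ext (s : C) : C :=
  if a s != 0 then F s / a s + S s else lim (F w / a w + S w @[w --> s^']).
Local Notation K := quotient_ext.

Lemma quotient_extE s : a s != 0 -> K s = F s / a s + S s.
Proof. by rewrite /K => ->. Qed.

Lemma quotient_ext_near p : a p != 0 ->
  exists2 d : R, 0 < d & forall z, cabs (z - p) < d -> a z != 0.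
Proof. by move=> ap; apply: cvg_near_neq0 ap; exact: has_jets_cvg. Qed.

Lemma quotient_ext_derivable p : a p != 0 -> derivable K p 1.
Proof.
move=> ap; have [d d0 hd] := quotient_ext_near ap.
apply: (@eq_derivable_cabs _ (fun z => F z / a z + S z) _ d) => //.
  by move=> z /hd; exact: quotient_extE.
have dF : derivable F p 1 by exact: has_jets_entire.
have da : derivable a p 1 by exact: has_jets_entire.
have dS : derivable S p 1 by exact: has_jets_entire.
exact: (holoD (holoM dF (holoV ap da)) dS).
Qed.

(** At a zero, [a (p + h) = h * g h] with [g] invertible near 0, and [Q] is [F / g]. Order 4 for [a]
    gives order 3 for [g] and [Q], hence order 2 for [e], which makes [e] differentiable at 0 when
    the singularity is removable. *)
Lemma quotient_ext_local p : a p = 0 -> exists2 r : R, 0 < r &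
  exists Q M e N (d : C), [/\ jet_le r 3 Q M, jet_le r 2 e N,
    forall h, cabs h <= r -> Q h = d + h * e h &
    forall h, cabs h <= r -> h != 0 -> a (p + h) != 0 /\ F (p + h) / a (p + h) = Q h / h].
Proof.
move=> ap; have [M [c [g [N [hg _ eg]]]]] := ha p 4.
have {}hg : jet_le 1 3 g N := hg.
have [c0 g0] := a_simple ap hg eg.
have [r /andP[r0 r1] [[N' hinv] nz]] := jet_le_inv hg g0.
have [L hL] := hF p 3.
have hQ := jet_leM (ltW r0) (jet_le_shrink (ltW r0) r1 hL) hinv.
exists r => //; have [d [e [N'' [he _ ee]]]] := hQ.
exists (fun h => F (p + h) * (g h)^-1), (L * N'), e, N'', d; split=> // h hr h0.
have gh := nz h hr; rewrite eg ?(le_trans hr)// c0 add0r mulf_neq0//; split=> //.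
by rewrite invfM mulrA mulrAC.
Qed.

Lemma quotient_ext_meromorphic : meromorphic K /\
  forall p k, pole_of_order K p k -> k = 1%N /\ a p = 0.
Proof.
have shift_cvg (r : R) k e N p : 0 < r -> jet_le r k.+1 e N ->
    (fun w => e (w - p)) w @[w --> p] --> e 0.
  move=> r0 he; have := @jet_le_cvg R r k (fun w => e (w - p)) N p r0.
  rewrite subrr; apply; apply: eq_jet_le he => h _.
  by rewrite addrAC subrr add0r.
split=> [p|p k pk].
  have [ap|ap] := eqVneq (a p) 0; last first.
    left; have [d d0 hd] := quotient_ext_near ap.
    by apply/nbhs_cabs; exists d => // z /hd; exact: quotient_ext_derivable.
  have [r r0 [Q [M [e [N [d [hQ he eQ hl]]]]]]] := quotient_ext_local ap.
  have near z : cabs (z - p) < r -> z != p -> a z != 0 /\ F z / a z = Q (z - p) / (z - p).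
    by move=> zr zp; have := hl (z - p); rewrite subrKC subr_eq0 => /(_ (ltW zr) zp).
  have Qd : Q 0 = d by rewrite eQ ?cabs0 ?ltW// mul0r addr0.
  (* The value [d] of [Q] at 0 decides: the singularity is removable if [d] vanishes, and a simple
     pole otherwise. *)
  have [d0|d0] := eqVneq d 0.
    left; apply/nbhs_cabs; exists r => // z zr.
    have [->{z zr}|zp] := eqVneq z p; last first.
      by have [+ _] := near z zr zp; exact: quotient_ext_derivable.
    have KE z : cabs (z - p) < r -> z != p -> F z / a z + S z = e (z - p) + S z.
      move=> zr zp; have [_ ->] := near z zr zp; rewrite eQ ?ltW// d0 add0r.
      by rewrite mulrC mulKf// subr_eq0.
    have Kp : K p = e 0 + S p.
      rewrite /K ap eqxx/=; apply: dnbhs_cvg_lim.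
      have h1 : e (w - p) + S w @[w --> p] --> e 0 + S p.
        have hs1 := shift_cvg _ _ _ _ p r0 he; have hs2 := has_jets_cvg (p := p) hS.
        exact: (cvgD hs1 hs2).
      have /cvg_dnbhs_cabs h2 := cvg_nbhs_dnbhs h1.
      apply/cvg_dnbhs_cabs => eps /h2[t t0 ht]; exists (Num.min r t); first by rewrite lt_min r0.
      by move=> z; rewrite lt_min => /andP[zr zt] zp; rewrite KE//; exact: ht.
    apply: (@eq_derivable_cabs _ (fun w => e (w - p) + S w) _ r) => //.
      move=> z zr; have [->|zp] := eqVneq z p; first by rewrite Kp subrr.
      by have [az _] := near z zr zp; rewrite quotient_extE// KE.
    apply: holoD; last exact: has_jets_entire.
    apply: (jet_le_derivable (r := r) (k := 0) (M := N)) => //.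
    by apply: eq_jet_le he => h _; rewrite addrAC subrr add0r.
  right; exists 1%N; split=> //.
  pose G w := Q (w - p) + (w - p) * S w.
  have hG z : cabs (z - p) < r -> z != p -> K z = G z / (z - p).
    move=> zr zp; have [az eF] := near z zr zp; rewrite quotient_extE// eF /G mulrDl.
    by rewrite [(z - p) * _]mulrC mulfK// subr_eq0.
  exists G; split.
  - apply/nbhs_cabs; exists r; first exact: r0.
    move=> z zr.
    have [->{z zr}|zp] := eqVneq z p.
      apply: holoD; last by apply: holoM; [exact: holo_sub_cst|exact: has_jets_entire].
      apply: (jet_le_derivable (r := r) (k := 1) (M := M)) => //.
      by apply: eq_jet_le hQ => h _; rewrite addrAC subrr add0r.
    have zp0 : 0 < cabs (z - p) by rewrite cabs_gt0 subr_eq0.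
    (* The jet of [Q] controls [G] only at its centre [p]. Elsewhere [G w] is [K w * (w - p)], on a
       disc that stays within radius [r] and avoids [p]. *)
    apply: (@eq_derivable_cabs _ (fun w => K w * (w - p)) _
      (Num.min (r - cabs (z - p)) (cabs (z - p)))).
    + by rewrite lt_min zp0 subr_gt0 zr.
    + move=> w; rewrite lt_min => /andP[w1 w2].
      have wp : w != p by apply: contraTneq w2 => ->; rewrite cabsB ltxx.
      have wr : cabs (w - p) < r.
        have := cabsD (w - z) (z - p); rewrite addrA subrK; lra.
      by rewrite hG// divfK// subr_eq0.
    + apply: holoM; last exact: holo_sub_cst.
      apply: quotient_ext_derivable.
      by have [] := near z zr zp.
  - by rewrite /G subrr mul0r addr0 Qd.
  - by apply/dnbhs_cabs; exists r => // z zr zp; rewrite expr1 hG.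
have ap : a p = 0.
  apply/eqP; apply: contraT => ap; have [k0 _] := pk.
  have kc := cvg_nbhs_dnbhs (derivable_cvg (quotient_ext_derivable ap)).
  have [] := not_pole k0 pk kc.
  by apply/dnbhs_cabs; exists 1 => // w _ _; rewrite expr0 mulr1.
split=> //; apply/eqP; rewrite eqn_leq; have [k0 _] := pk; rewrite k0 andbT leqNgt.
apply/negP => k1.
have [r r0 [Q [M [e [N [d [hQ he eQ hl]]]]]]] := quotient_ext_local ap.
have hc : Q (w - p) + (w - p) * S w @[w --> p] --> Q 0 + (p - p) * S p.
  have hs1 := shift_cvg _ _ _ _ p r0 hQ.
  have dS : derivable S p 1 by exact: has_jets_entire.
  have hs2 := derivable_cvg (holoM (@holo_sub_cst p p) dS).
  exact: (cvgD hs1 hs2).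
apply: (not_pole k1 pk (cvg_nbhs_dnbhs hc)).
apply/dnbhs_cabs; exists r => // z zr zp; have zp0 : z - p != 0 by rewrite subr_eq0.
have := hl (z - p); rewrite subrKC => /(_ (ltW zr) zp0)[az eF].
by rewrite quotient_extE// eF expr1 mulrDl divfK// [S z * _]mulrC.
Qed.

End Quotient.

(** * The analytic continuation *)

Lemma kempner_sumE (R : realType) (b : nat) (A : {set 'I_b}) (hb : (1 < b)%N)
    (hA : exists2 a : 'I_b, a \in A & (a : nat) != 0%N) (s : Cplx R) :
  ln (#|A|%:R : R) / ln (b%:R : R) < complex.Re s ->
  limn (series (fun m => kempner_term A m s)) =
  alpha A s * (kempner A s - \sum_(a in nonzero_digits A) npow a (- s)).
Proof.
move=> hs; rewrite (kempnerE hb hA hs) addrAC subrr add0r mulr_sumr.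
under [RHS]eq_bigr do rewrite mulr_sumr.
have uE m : alpha_u A m s = alpha A s * u A m s.
  have [_ h] := @alpha_uP R b A hb m.
  exact: (h s (fun j _ => npow_gt_card hb hA hs j)).
have -> : series (fun m => kempner_term A m s) = (fun k =>
  \sum_(a1 in nonzero_digits A) \sum_(a2 in A) alpha A s * npow (a1 * b + a2)%N (- s) *
    series (fun m => binom_coef s m * ((a1 * b + a2)%N%:R ^+ m)^-1 * u A m s) k).
  apply/funext => k; rewrite seriesE.
  under [in RHS]eq_bigr do under eq_bigr do rewrite seriesE mulr_sumr.
  under [in RHS]eq_bigr do rewrite exchange_big.
  rewrite exchange_big/=; apply: eq_bigr => m _.
  rewrite /kempner_term mulr_sumr; apply: eq_bigr => a1; rewrite inE => /andP[_ a1n].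
  rewrite mulr_sumr; apply: eq_bigr => a2 _.
  have n0 : (0 < a1 * b + a2)%N by rewrite addn_gt0 muln_gt0 lt0n a1n (ltnW hb).
  rewrite npow_sub_nat// uE /binom_coef.
  move: (npow (a1 * b + a2)%N (- s)) (alpha A s) (u A m s) => x y z.
  move: (pochhammer s m / m`!%:R) ((-1) ^+ m) (_ ^- m) => t v w.
  by ring.
apply: cvgn_limE; apply: cvgn_sum => a1; rewrite inE => /andP[_ a1n].
apply: cvgn_sum => a2 _; rewrite mulrA; apply: cvgn_mull.
apply: (block_sum_cvg hb hA hs); apply: leq_trans hb _.
by apply: leq_trans (leq_addr _ _); rewrite leq_pmull// lt0n.
Qed.

Theorem corollary2p4 (R : realType) (b : nat) (A : {set 'I_b})
    (hb : (1 < b)%N) (hA : exists2 a : 'I_b, a \in A & (a : nat) != 0%N) :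
  [/\ forall m : nat, entire (kempner_term A m : Cplx R -> Cplx R),
      forall s : Cplx R, cvgn (series (fun m => kempner_term A m s)),
      entire (fun s : Cplx R => limn (series (fun m => kempner_term A m s))),
      forall s : Cplx R, ln (#|A|%:R : R) / ln (b%:R : R) < complex.Re s ->
        limn (series (fun m => kempner_term A m s)) =
        alpha A s *
          (kempner A s - \sum_(a in nonzero_digits A) npow a (- s))
    & exists K : Cplx R -> Cplx R,
        [/\ meromorphic K,
            forall s : Cplx R,
              ln (#|A|%:R : R) / ln (b%:R : R) < complex.Re s ->
              K s = kempner A s
          & forall (p : Cplx R) (k : nat), pole_of_order K p k ->
              k = 1%N /\ alpha A p = 0]].
Proof.
have [termj [termc sumj]] := @kempner_sum_has_jets R b A hb.
split=> [m||||].
- exact: has_jets_entire.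
- exact: termc.
- exact: has_jets_entire.
- by move=> s; exact: kempner_sumE.
pose S (s : Cplx R) := \sum_(a in nonzero_digits A) npow a (- s).
have Sj : has_jets S.
  apply: has_jets_sum => a _ p k; have [M hM] := @has_jets_npowN R a 0 p k.
  by exists M; apply: eq_jet_le hM => h _; rewrite addr0.
have simple p k g (c : Cplx R) M : alpha A p = 0 -> jet_le 1 k.+1 g M ->
    (forall h, cabs h <= 1 -> alpha A (p + h) = c + h * g h) -> c = 0 /\ g 0 != 0.
  exact: alpha_simple_zero.
have aj := @alpha_has_jets R b A hb.
have [Km Kp] := quotient_ext_meromorphic sumj aj Sj simple.
(* The half-plane identity solved for [kempner A s]: the series divided by [alpha], plus the sum
   over single digits. *)
exists (quotient_ext (fun s => limn (series (fun m => kempner_term A m s))) (alpha A) S).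
split=> // s hs.
have as0 : alpha A s != 0.
  by apply/eqP => /(alpha_eq0 hb)[n /eqP]; apply/negP; exact: (npow_gt_card hb hA hs).
by rewrite quotient_extE// kempner_sumE// mulrAC divff// mul1r subrK.
Qed.
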